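(* Let $A$ be a Banach algebra. Then $\mathcal F(A)$ is Connes-amenable if and only if $A$ has a $\mathrm{WAP}$-virtual diagonal.
   Context: All modules are Banach modules; all maps are linear and norm-continuous. The dual $X^*$ of an $A$-bimodule $X$ is an $A$-bimodule via $(a\cdot\phi)(x)=\phi(x\cdot a)$, $(\phi\cdot a)(x)=\phi(a\cdot x)$. For an $A$-bimodule $E$, $\mathrm{WAP}_A(E)$ is the closed sub-bimodule of all $x\in E$ for which the orbit maps $A\to E$, $a\mapsto a\cdot x$ and $a\mapsto x\cdot a$ are both weakly compact. Put $\mathcal F_A(X)_*=\mathrm{WAP}_A(X^* )$ and $\mathcal F_A(X)=(\mathcal F_A(X)_* )^*$, a dual $A$-bimodule. Let $\eta_X:X\to\mathcal F_A(X)$ be the canonical embedding $X\to X^{**}$ followed by the adjoint of the inclusion $\mathrm{WAP}_A(X^* )\hookrightarrow X^*$. For $X=A$ write $\mathcal F(A)=\mathcal F_A(A)$ and $\mathcal F(A)_*=\mathrm{WAP}_A(A^* )$. $\mathcal F(A)$ carries the unique product for which the natural quotient map $A^{**}\to\mathcal F(A)$ is a homomorphism when $A^{**}$ has the first Arens product; this makes it a dual Banach algebra with predual $\mathcal F(A)_*$. A Banach algebra $B$ is a dual Banach algebra with predual $B_*$ if $B_*\subseteq B^*$ is a closed sub-$B$-bimodule such that the natural map $B\to B^{**}\to(B_* )^*$ is bijective. A normal dual $B$-bimodule is the dual bimodule $M=(M_* )^*$ of a Banach $B$-bimodule $M_*$ such that for each $x\in M$ the maps $B\to M$, $b\mapsto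 b\cdot x$ and $b\mapsto x\cdot b$ are weak*-weak* continuous. $B$ is Connes-amenable if every weak*-weak* continuous derivation from $B$ to a normal dual $B$-bimodule $M$ is inner (of the form $b\mapsto b\cdot n-n\cdot b$ for some $n\in M$). The projective tensor product $A\hat\otimes A$ is an $A$-bimodule via $a\cdot(b\otimes c)=ab\otimes c$, $(b\otimes c)\cdot a=b\otimes ca$. $\Delta:A\hat\otimes A\to A$ is the product map, and $\Delta_{\mathrm{WAP}}:\mathcal F_A(A\hat\otimes A)\to\mathcal F(A)$ is the adjoint of $\Delta^*:\mathrm{WAP}_A(A^* )\to\mathrm{WAP}_A((A\hat\otimes A)^* )$. A $\mathrm{WAP}$-virtual diagonal for $A$ is an element $m\in\mathcal F_A(A\hat\otimes A)$ with $a\cdot m=m\cdot a$ and $\Delta_{\mathrm{WAP}}(m)\cdot a=\eta_A(a)$ for each $a\in A$. *)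

(* Defs.v *)
From HB Require Import structures.
From mathcomp Require Import all_boot all_order all_algebra.
From mathcomp Require Import complex ring.
From mathcomp Require Import all_classical all_reals all_analysis.

Set Implicit Arguments.
Unset Strict Implicit.
Unset Printing Implicit Defensive.

Import Order.TTheory GRing.Theory Num.Theory.
Import numFieldNormedType.Exports.

Local Open Scope classical_set_scope.
Local Open Scope complex_scope.
Local Open Scope ring_scope.

(* Banach spaces are complex: completeNormedModType R[i] for R : realType.  The
   library only gives R[i]^o, not R[i], its normed-module structure; norms of
   normed R[i]-modules are nonnegative elements of R[i]. *)

Section ComplexComplete.
Context (R : realType).
Local Notation C := (R[i]).

HB.instance Definition _ := GRing.ComAlgebra.copy C C^o.
HB.instance Definition _ := Vector.copy C C^o.
HB.instance Definition _ := NormedModule.copy C C^o.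

Lemma normCR (z : C) : `|z| = (complex.Re `|z|)%:C.
Proof. by rewrite normc_def. Qed.

Lemma ge0_ReE (k : C) : 0 <= k -> k = (complex.Re k)%:C.
Proof. by move=> /ger0_norm <-; exact: normCR. Qed.

Lemma normC_le_Re_Im (z : C) : `|z| <= (`|complex.Re z| + `|complex.Im z|)%:C.
Proof.
rewrite normc_def lecR -[leRHS]ger0_norm ?addr_ge0// -sqrtr_sqr ler_sqrt ?sqr_ge0//.
rewrite sqrrD !real_normK ?num_real// -addrA lerD2l lerDr.
by rewrite mulrn_wge0// mulr_ge0.
Qed.

Lemma normC_ge_Im (z : C) : `|complex.Im z|%:C <= `|z|.
Proof.
rewrite normc_def lecR -[leLHS]ger0_norm // -sqrtr_sqr ler_sqrt.
  by rewrite real_normK ?num_real// lerDr sqr_ge0.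
by rewrite addr_ge0 ?sqr_ge0.
Qed.

Lemma complex_complete (F : set_system C) :
  ProperFilter F -> cauchy F -> cvg F.
Proof.
move=> FF /cauchy_ballP Fc.
have cF (p : C -> R) : (forall x y, p (x - y) = p x - p y) ->
    (forall z : C, `|p z|%:C <= `|z|) -> cvg (p @ F).
  move=> pB ple; apply/cauchy_cvgP/cauchy_ballP => e e0.
  have := Fc e%:C; rewrite ltcR => /(_ e0).
  rewrite !near_simpl => -[] [A B] /= [FA FB] AB.
  exists (p @` A, p @` B).
    by split => /=; [move: FA|move: FB]; apply: filterS => x Hx; exists x.
  move=> [_ _] [/= [x Ax <-] [y By <-]] /=.
  have := AB (x, y) (conj Ax By); rewrite /= -!ball_normE /= -pB => xy.
  by rewrite -ltcR; apply: le_lt_trans (ple _) xy.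
have ReB (x y : C) : complex.Re (x - y) = complex.Re x - complex.Re y.
  by case: x y => a b [].
have ImB (x y : C) : complex.Im (x - y) = complex.Im x - complex.Im y.
  by case: x y => a b [].
have /cvg_ex[a Ha] := cF _ ReB (@normc_ge_Re R).
have /cvg_ex[b Hb] := cF _ ImB normC_ge_Im.
apply/cvg_ex; exists (a +i* b); apply/cvgrPdist_lt => e e0.
have eR : e = (complex.Re e)%:C by exact/ge0_ReE/ltW.
have e'0 : 0 < complex.Re e by rewrite eR ltcR in e0.
have e20 : 0 < complex.Re e / 2 by rewrite divr_gt0.
move/cvgrPdist_lt : Ha => /(_ _ e20) Ha.
move/cvgrPdist_lt : Hb => /(_ _ e20) Hb.
near=> z; apply: (le_lt_trans (normC_le_Re_Im _)).
rewrite eR ltcR [ltRHS]splitr ReB ImB /=; apply: ltrD.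
  by near: z; exact: Ha.
by near: z; exact: Hb.
Unshelve. all: by end_near. Qed.

HB.instance Definition _ := Uniform_isComplete.Build C complex_complete.

End ComplexComplete.

Section BoundedLinear.
Context (R : realType).
Local Notation C := (R[i]).

(* Continuous linear maps; with opnorm below, blin E F is the normed space of
   bounded operators, and dual E = blin E R[i] is the dual of E. *)
Record blin (E F : normedModType C) := Blin {
  blin_fun :> E -> F;
  blin_lin : linear blin_fun;
  blin_cont : continuous blin_fun }.

HB.instance Definition _ (E F : normedModType C) (f : blin E F) :=
  GRing.isLinear.Build C E F *:%R (blin_fun f) (blin_lin f).

Section Theory.
Context (E F : normedModType C).
Implicit Types f g : blin E F.

Lemma blinP f g : (forall x, f x = g x) -> f = g.
Proof.
case: f g => f lf cf [g lg cg] /= /funext fg; subst g.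
by rewrite (Prop_irrelevance lf lg) (Prop_irrelevance cf cg).
Qed.

Lemma blin_bounded f :
  exists k : R, 0 <= k /\ forall x, `|f x| <= k%:C * `|x|.
Proof.
have /linear_bounded_continuous/linear_boundedP/pinfty_ex_gt0[k k0 kP] :=
  @blin_cont _ _ f.
have kE : k = (complex.Re k)%:C by exact/ge0_ReE/ltW.
by exists (complex.Re k); rewrite -kE; split => //; rewrite -lecR -kE ltW.
Qed.

Lemma bounded_cont (f : {linear E -> F}) (k : C) :
  (forall x, `|f x| <= k * `|x|) -> continuous f.
Proof.
move=> fk; apply/linear_bounded_continuous/linear_boundedP.
near=> r => x; apply: le_trans (fk x) _.
rewrite -[leLHS]ger0_norm ?(le_trans _ (fk x))// normrM normr_id ler_wpM2r//.
Unshelve. all: by end_near. Qed.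

Lemma bounded_linear_cont (h : E -> F) : linear h ->
  (exists k : C, forall x, `|h x| <= k * `|x|) -> continuous h.
Proof.
move=> lh [k hk]; pose h' : {linear E -> F} :=
  HB.pack h (GRing.isLinear.Build _ _ _ _ _ lh).
exact: (@bounded_cont h' k).
Qed.

Definition mkblin (h : E -> F) (lh : linear h)
    (bh : exists k : C, forall x, `|h x| <= k * `|x|) : blin E F :=
  Blin lh (bounded_linear_cont lh bh).

Let zero_lin : linear (fun _ : E => 0 : F).
Proof. by move=> a x y; rewrite scaler0 addr0. Qed.
Let zero_bnd : exists k : C, forall x : E, `|0 : F| <= k * `|x|.
Proof. by exists 0 => x; rewrite normr0 mul0r. Qed.
Definition blin0 := mkblin zero_lin zero_bnd.

Let add_lin f g : linear (fun x => f x + g x).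
Proof. by move=> a x y; rewrite !linearP scalerDr addrACA. Qed.
Let add_bnd f g : exists k : C, forall x, `|f x + g x| <= k * `|x|.
Proof.
have [[k [_ kP]] [l [_ lP]]] := (blin_bounded f, blin_bounded g).
exists (k%:C + l%:C) => x; rewrite mulrDl.
by apply: le_trans (ler_normD _ _) _; exact: lerD.
Qed.
Definition blin_add f g := mkblin (add_lin f g) (add_bnd f g).

Let scale_lin (c : C) f : linear (fun x => c *: f x).
Proof. by move=> a x y; rewrite linearP scalerDr !scalerA mulrC. Qed.
Let scale_bnd (c : C) f : exists k : C, forall x, `|c *: f x| <= k * `|x|.
Proof.
have [k [_ kP]] := blin_bounded f; exists (`|c| * k%:C) => x.
by rewrite normrZ -mulrA ler_wpM2l.
Qed.
Definition blin_scale (c : C) f := mkblin (scale_lin c f) (scale_bnd c f).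

Let opp_lin f : linear (fun x => - f x).
Proof. by move=> a x y; rewrite linearP opprD scalerN. Qed.
Let opp_bnd f : exists k : C, forall x, `|- f x| <= k * `|x|.
Proof.
by have [k [_ kP]] := blin_bounded f; exists k%:C => x; rewrite normrN.
Qed.
Definition blin_opp f := mkblin (opp_lin f) (opp_bnd f).

HB.instance Definition _ := gen_eqMixin (blin E F).
HB.instance Definition _ := gen_choiceMixin (blin E F).

Let addA : associative blin_add.
Proof. by move=> f g h; apply: blinP => x /=; rewrite addrA. Qed.
Let addC : commutative blin_add.
Proof. by move=> f g; apply: blinP => x /=; rewrite addrC. Qed.
Let add0 : left_id blin0 blin_add.
Proof. by move=> f; apply: blinP => x /=; rewrite add0r. Qed.
Let addN : left_inverse blin0 blin_opp blin_add.
Proof. by move=> f; apply: blinP => x /=; rewrite addNr. Qed.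

HB.instance Definition _ := GRing.isZmodule.Build (blin E F) addA addC add0 addN.

Let scaleA a b f : blin_scale a (blin_scale b f) = blin_scale (a * b) f.
Proof. by apply: blinP => x /=; rewrite scalerA. Qed.
Let scale1 : left_id 1 blin_scale.
Proof. by move=> f; apply: blinP => x /=; rewrite scale1r. Qed.
Let scaleDr : right_distributive blin_scale +%R.
Proof. by move=> c f g; apply: blinP => x /=; rewrite scalerDr. Qed.
Let scaleDl f : {morph blin_scale^~ f : a b / a + b}.
Proof. by move=> a b; apply: blinP => x /=; rewrite scalerDl. Qed.

HB.instance Definition _ := GRing.Zmodule_isLmodule.Build C (blin E F)
  scaleA scale1 scaleDr scaleDl.

Lemma blin0E x : (0 : blin E F) x = 0. Proof. by []. Qed.
Lemma blinDE f g x : (f + g) x = f x + g x. Proof. by []. Qed.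
Lemma blinNE f x : (- f) x = - f x. Proof. by []. Qed.
Lemma blinBE f g x : (f - g) x = f x - g x. Proof. by []. Qed.
Lemma blinZE c f x : (c *: f) x = c *: f x. Proof. by []. Qed.

(* sup of `|f x| over the unit ball; the supremum is taken in R. *)
Definition opnorm f : C :=
  (sup [set complex.Re `|f x| | x in [set x : E | `|x| <= 1]])%:C.

Let normER (V : normedModType C) (x : V) : `|x| = (complex.Re `|x|)%:C.
Proof. exact: ge0_ReE. Qed.

Let opnorm_has_sup f :
  has_sup [set complex.Re `|f x| | x in [set x : E | `|x| <= 1]].
Proof.
split; first by exists (complex.Re `|f 0|), 0 => //=; rewrite normr0.
have [k [k0 kP]] := blin_bounded f; exists k => _ [x /= x1 <-].
rewrite -lecR -normER (le_trans (kP x))// -[leRHS]mulr1 ler_wpM2l//.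
by rewrite lecR.
Qed.

Lemma opnorm_ge0 f : 0 <= opnorm f.
Proof.
rewrite lecR; apply: le_trans (_ : complex.Re `|f 0| <= _).
  by rewrite linear0 normr0.
by apply: ub_le_sup; [case: (opnorm_has_sup f)|exists 0 => //=; rewrite normr0].
Qed.

Lemma le_opnorm f x : `|f x| <= opnorm f * `|x|.
Proof.
have [->|x0] := eqVneq x 0; first by rewrite linear0 !normr0 mulr0.
have nx : 0 < `|x| by rewrite normr_gt0.
rewrite -ler_pdivrMr// mulrC -[X in X * _]gtr0_norm ?invr_gt0// -normrZ -linearZ.
rewrite (normER (f _)) lecR; apply: ub_le_sup; first by case: (opnorm_has_sup f).
exists (`|x|^-1 *: x) => //=.
by rewrite normrZ gtr0_norm ?invr_gt0// mulVf ?gt_eqF.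
Qed.

Lemma opnorm_le f (k : C) : 0 <= k -> (forall x, `|f x| <= k * `|x|) ->
  opnorm f <= k.
Proof.
move=> k0 kP.
have kE : k = (complex.Re k)%:C by exact: ge0_ReE.
rewrite kE lecR; apply: ge_sup; first by case: (opnorm_has_sup f).
move=> _ [x /= x1 <-]; rewrite -lecR -kE -normER (le_trans (kP x))//.
by rewrite -[leRHS]mulr1 ler_wpM2l.
Qed.

Let opnormD f g : opnorm (f + g) <= opnorm f + opnorm g.
Proof.
apply: opnorm_le => [|x]; first by rewrite addr_ge0 ?opnorm_ge0.
by rewrite mulrDl (le_trans (ler_normD _ _))// lerD ?le_opnorm.
Qed.

Let opnormZ_le c f : opnorm (c *: f) <= `|c| * opnorm f.
Proof.
apply: opnorm_le => [|x]; first by rewrite mulr_ge0 ?opnorm_ge0.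
by rewrite blinZE normrZ -mulrA ler_wpM2l ?le_opnorm.
Qed.

Let opnorm0_eq0 f : opnorm f = 0 -> f = 0.
Proof.
move=> f0; apply: blinP => x; apply/normr0_eq0/le_anti.
by rewrite normr_ge0 (le_trans (le_opnorm f x))// f0 mul0r.
Qed.

Let opnormZ c f : opnorm (c *: f) = `|c| * opnorm f.
Proof.
have [->|c0] := eqVneq c 0.
  rewrite normr0 mul0r scale0r; apply/le_anti; rewrite opnorm_ge0 andbT.
  by apply: opnorm_le => // x; rewrite blin0E normr0 mul0r.
apply/le_anti; rewrite opnormZ_le/=.
rewrite -ler_pdivlMl ?normr_gt0// -normfV.
by rewrite -[in X in X <= _](scalerK c0 f) opnormZ_le.
Qed.

HB.instance Definition _ := Lmodule_isNormed.Build C (blin E F)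
  opnormD opnormZ opnorm0_eq0.

Lemma blin_normE f : `|f| = opnorm f. Proof. by []. Qed.

Lemma le_blin_norm f x : `|f x| <= `|f| * `|x|.
Proof. exact: le_opnorm. Qed.

Lemma blin_norm_le f (k : C) :
  0 <= k -> (forall x, `|f x| <= k * `|x|) -> `|f| <= k.
Proof. exact: opnorm_le. Qed.

End Theory.

Section Complete.
Context (E : normedModType C) (F : completeNormedModType C).

Lemma blin_complete (G : set_system (blin E F)) :
  ProperFilter G -> cauchy G -> cvg G.
Proof.
move=> GG /cauchy_ballP Gc.
have Gb (e : C) : 0 < e -> exists f0, \forall f \near G, `|f0 - f| <= e.
  move=> e0; have [[A B] /= [GA GB] AB] := Gc _ e0.
  have /filter_ex[f0 Af0] : G A by [].
  exists f0; near=> f; have := AB (f0, f) (conj Af0 _); rewrite /= -ball_normE.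
  by move=> H; apply/ltW/H; near: f.
have cvgx x : cvg ((fun f : blin E F => f x) @ G).
  apply/cauchy_cvgP/cauchy_ballP => e e0.
  have d0 : 0 < e / (1 + `|x|) by rewrite divr_gt0 ?ltr_pwDl.
  have [[A B] /= [GA GB] AB] := Gc _ d0.
  exists ((fun f : blin E F => f x) @` A, (fun f : blin E F => f x) @` B).
    by split => /=; [move: GA|move: GB]; apply: filterS => f Hf; exists f.
  move=> [_ _] [/= [f Af <-] [h Bh <-]] /=.
  have := AB (f, h) (conj Af Bh); rewrite /= -!ball_normE /= -blinBE => fh.
  apply: le_lt_trans (le_blin_norm (f - h) x) _.
  have [->|x0] := eqVneq x 0; first by rewrite normr0 mulr0.
  rewrite -lter_pdivlMr ?normr_gt0//; apply: lt_trans fh _.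
  by rewrite ltr_pM2l// ltf_pV2 ?posrE ?ltr_pwDl ?normr_gt0// ltrDr.
pose g x := lim ((fun f : blin E F => f x) @ G).
have gcvg x : (fun f : blin E F => f x) @ G --> g x by exact: cvgx.
have glin : linear g.
  move=> a x y; apply: cvg_lim => //.
  under eq_cvg do rewrite linearP.
  by apply: cvgD; [apply: cvgZ; [exact: cvg_cst|exact: gcvg]|exact: gcvg].
have gle e f0 : 0 < e -> (\forall f \near G, `|f0 - f| <= e) ->
    forall x : E, `|f0 x - g x| <= e * `|x|.
  move=> e0 Gf0 z.
  apply/ler_addgt0Pr => d d0.
  have /cvgrPdist_le/(_ _ d0) gd := gcvg z; near G => f.
  rewrite -(subrKA (f z)) (le_trans (ler_normD _ _))// lerD//.
    rewrite -blinBE (le_trans (le_blin_norm _ _))// ler_wpM2r//.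
    by near: f.
  by rewrite distrC; near: f.
have gbnd : exists k : C, forall x, `|g x| <= k * `|x|.
  have [f0 Gf0] := Gb 1 ltr01; exists (`|f0| + 1) => x.
  rewrite -[g x](subKr (f0 x)) mulrDl (le_trans (ler_normB _ _))// lerD//.
    exact: le_blin_norm.
  exact: gle.
pose g' := mkblin glin gbnd.
apply/cvg_ex; exists g'; apply/cvgrPdist_le => e e0.
have e20 : 0 < e / 2 by rewrite divr_gt0.
have [f0 Gf0] := Gb _ e20; near=> f.
rewrite -(subrKA f0) [leRHS]splitr (le_trans (ler_normD _ _))// lerD//.
  rewrite distrC; apply: blin_norm_le (ltW e20) _ => x.
  exact: gle.
by near: f.
Unshelve. all: by end_near. Qed.

HB.instance Definition _ := Uniform_isComplete.Build (blin E F) blin_complete.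

End Complete.
End BoundedLinear.

Notation dual E := (blin E (_ [i])).

Lemma compact_precompact (X : uniformType) (K : set X) :
  compact K -> precompact K.
Proof.
move=> Kco; rewrite precompactE => F FF FK.
pose g (p : set X * set (X * X)) := K `&` [set y | exists2 x, p.1 x & p.2 (x, y)].
pose G := filter_from [set p | F p.1 /\ entourage p.2] g.
have GF : ProperFilter G.
  apply: filter_from_proper; first apply: filter_from_filter.
  - by exists (setT, setT); split => /=; [exact: filterT|exact: entourageT].
  - move=> [A U] [B V] /= [FA eU] [FB eV]; exists (A `&` B, U `&` V).
      by split => /=; exact: filterI.
    by move=> y [Ky /= [x [Ax Bx] [Ux Vx]]]; split; split=> //=; exists x.
  - move=> [A U] [/= FA eU].
    have FAK : F (A `&` closure K) by exact: filterI.
    have [x [Ax Kx]] := filter_ex FAK.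
    have [y [Ky /xsectionP Uy]] := Kx _ (nbhs_entourage x eU).
    by exists y; split => //=; exists x.
have GK : G K.
  exists (setT, setT); last by move=> y [].
  by split => /=; [exact: filterT|exact: entourageT].
have [y [Ky cy]] := Kco G GF GK.
exists y; split; first exact: subset_closure.
move=> A B FA; rewrite -nbhs_entourageE => -[E entE EB].
have eS := entourage_split_ent entE.
have [||z [/= [_ [x Ax Sx]] /xsectionP zS]] :=
  cy (g (A, (split_ent E)^-1%relation)) (xsection (split_ent E) y).
- by exists (A, (split_ent E)^-1%relation) => //; split => //=; exact: entourage_inv.
- exact: nbhs_entourage.
- exists x; split => //; apply/EB/xsectionP.
  by apply: (entourage_split z).
Qed.

Section Weak.
Context (R : realType).
Local Notation C := (R[i]).

(* The topology sigma(T, I) on T defined by a pairing p : T * I -> C. *)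
Definition sigma_topology (T I : Type) (p : T -> I -> C) : Type :=
  initial_topology (p : T -> {ptws I -> C}).

HB.instance Definition _ (T : choiceType) (I : Type) (p : T -> I -> C) :=
  Uniform.copy (sigma_topology p) (initial_topology (p : T -> {ptws I -> C})).

Lemma sigma_eval_continuous (T : choiceType) (I : Type) (p : T -> I -> C) i :
  continuous ((fun x => p x i) : sigma_topology p -> C).
Proof.
move=> x; pose q := p : T -> {ptws I -> C}.
have q1 : q @ nbhs (x : initial_topology q) --> q x by exact: initial_continuous.
have /cvg_sup/(_ i) q2 := q1.
apply: (cvg_trans (cvg_app (fun g : I -> C => g i) q2)).
exact: (@initial_continuous _ _ (fun g : I -> C => g i)).
Qed.

Lemma sigma_continuousP (X : topologicalType) (T : choiceType) (I : Type)
    (p : T -> I -> C) (h : X -> sigma_topology p) :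
  continuous h <-> forall i, continuous (fun x => p (h x) i : C).
Proof.
split=> [hc i x|hc].
  exact: (cvg_comp _ _ (hc x) (@sigma_eval_continuous T I p i (h x))).
apply: continuous_comp_initial => x; apply/cvg_sup => i; move: x.
exact: (@continuous_comp_initial (prod_topology (fun _ : I => C)) X C
  (fun g => g i) _ (hc i)).
Qed.

Definition weak (E : normedModType C) : Type :=
  sigma_topology (fun (x : E) (f : dual E) => f x).
HB.instance Definition _ (E : normedModType C) := Uniform.on (weak E).

Definition weak_star (E : normedModType C) : Type :=
  sigma_topology (fun (f : dual E) (x : E) => f x).
HB.instance Definition _ (E : normedModType C) := Uniform.on (weak_star E).

Definition weakly_compact_map (E F : normedModType C) (T : E -> F) : Prop :=
  precompact ((T : E -> weak F) @` [set x | `|x| <= 1]).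

Lemma precompact_sub_compact (X : uniformType) (A : set X) :
  precompact A <-> exists2 K, compact K & A `<=` K.
Proof.
split=> [|[K Kco AK]]; last exact: precompact_subset (compact_precompact Kco).
by rewrite precompactE => clA; exists (closure A) => //; exact: subset_closure.
Qed.

Lemma weak_eval_continuous (E : normedModType C) (f : dual E) :
  continuous (f : weak E -> C).
Proof. exact: (@sigma_eval_continuous _ _ (fun (x : E) (f : dual E) => f x) f). Qed.

Lemma weakly_compact_map0 (E F : normedModType C) :
  weakly_compact_map (fun _ : E => 0 : F).
Proof.
apply/precompact_sub_compact; exists [set 0]; first exact: compact_set1.
by move=> _ [x _ <-].
Qed.

Lemma weakly_compact_mapP (E F : normedModType C) (a : C) (S T : E -> F) :
  weakly_compact_map S -> weakly_compact_map T ->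
  weakly_compact_map (fun x => a *: S x + T x).
Proof.
move=> /precompact_sub_compact[K Kco SK] /precompact_sub_compact[L Lco TL].
apply/precompact_sub_compact.
pose h (z : weak F * weak F) : weak F := a *: (z.1 : F) + (z.2 : F).
exists (h @` (K `*` L)).
  apply: continuous_compact; last exact: compact_setX.
  apply: continuous_subspaceT; apply/sigma_continuousP => f.
  have -> : (fun x => f (h x)) = (fun x => a *: f x.1 + f x.2).
    by apply/funext => x; rewrite linearP.
  move=> z; rewrite /continuous_at.
  apply: cvgD; last first.
    by apply: (cvg_comp snd f); [exact: cvg_snd|exact: weak_eval_continuous].
  apply: cvgZ; first exact: cvg_cst.
  by apply: (cvg_comp fst f); [exact: cvg_fst|exact: weak_eval_continuous].
move=> _ [x x1 <-]; exists (S x, T x) => //; split => /=.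
  by apply: SK; exists x.
by apply: TL; exists x.
Qed.

End Weak.

Section Operators.
Context (R : realType).
Local Notation C := (R[i]).

Section Comp.
Context (E F G : normedModType C) (S : blin F G) (T : blin E F).
Let comp_lin : linear (fun x => S (T x)).
Proof. by move=> a x y; rewrite !linearP. Qed.
Let comp_bnd : exists k : C, forall x, `|S (T x)| <= k * `|x|.
Proof.
exists (`|S| * `|T|) => x; rewrite -mulrA (le_trans (le_blin_norm _ _))//.
by rewrite ler_wpM2l ?le_blin_norm.
Qed.
Definition blin_comp : blin E G := mkblin comp_lin comp_bnd.
End Comp.

Lemma blin_weak_continuous (E F : normedModType C) (T : blin E F) :
  continuous (T : weak E -> weak F).
Proof.
apply/sigma_continuousP => f x.
exact: (weak_eval_continuous (f := blin_comp f T) (x := x)).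
Qed.

Lemma weakly_compact_map_comp (E F G : normedModType C) (S : blin F G)
    (T : E -> F) :
  weakly_compact_map T -> weakly_compact_map (S \o T).
Proof.
move=> /precompact_sub_compact[K Kco TK]; apply/precompact_sub_compact.
exists ((S : weak F -> weak G) @` K).
  apply: continuous_compact => //.
  by apply: continuous_subspaceT; exact: blin_weak_continuous.
by move=> _ [x x1 <-]; exists (T x) => //; apply: TK; exists x.
Qed.

Lemma weakly_compact_map_precomp (E F G : normedModType C) (S : blin E F)
    (T : blin F G) :
  weakly_compact_map T -> weakly_compact_map (T \o S).
Proof.
move=> /precompact_sub_compact[K Kco TK]; apply/precompact_sub_compact.
have S1 : 0 < `|S| + 1 by rewrite ltr_wpDl.
pose c : weak G -> weak G := ( *:%R (`|S| + 1)) : G -> G.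
exists (c @` K).
  apply: continuous_compact => //; apply: continuous_subspaceT.
  apply/sigma_continuousP => f.
  have -> : (fun x => f (c x)) = (fun x => (`|S| + 1) *: f x).
    by apply/funext => x; rewrite linearZ.
  exact: (weak_eval_continuous (f := (`|S| + 1) *: f)).
move=> _ [x /= x1 <-]; exists (T ((`|S| + 1)^-1 *: S x)).
  apply: TK; exists ((`|S| + 1)^-1 *: S x) => //=.
  rewrite normrZ gtr0_norm ?invr_gt0// ler_pdivrMl// mulr1.
  rewrite (le_trans (le_blin_norm S x))// -[leRHS]mulr1 ler_pM// lerDl//.
by rewrite /c linearZ/= scalerA divff ?scale1r// gt_eqF.
Qed.

Section Adjoint.
Context (E F : normedModType C) (T : blin E F).
Let adj_lin : linear (fun f : dual F => blin_comp f T).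
Proof. by move=> a f g; exact: blinP. Qed.
Let adj_bnd :
  exists k : C, forall f : dual F, `|blin_comp f T| <= k * `|f|.
Proof.
exists `|T| => f; apply: blin_norm_le => [|x]; first by rewrite mulr_ge0.
apply: le_trans (le_blin_norm f (T x)) _; rewrite (mulrC `|T|) -mulrA.
by rewrite ler_wpM2l ?le_blin_norm.
Qed.
Definition adjoint : blin (dual F) (dual E) := mkblin adj_lin adj_bnd.
End Adjoint.

Section Bidual.
Context (E : normedModType C).
Definition dual_eval (x : E) : dual (dual E).
Proof.
refine (@mkblin _ (dual E) C (fun f => f x) _ _).
- by [].
- by exists `|x| => f; rewrite mulrC le_blin_norm.
Defined.
Let bidual_lin : linear dual_eval.
Proof. by move=> a x y; apply: blinP => f /=; rewrite linearP. Qed.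
Let bidual_bnd : exists k : C, forall x, `|dual_eval x| <= k * `|x|.
Proof.
exists 1 => x; rewrite mul1r; apply: blin_norm_le => // f.
by rewrite mulrC; exact: (le_blin_norm f x).
Qed.
Definition bidual : blin E (dual (dual E)) := mkblin bidual_lin bidual_bnd.
End Bidual.

Record subspace (E : normedModType C) := Subspace {
  subspace_set : set E;
  subspace0 : subspace_set 0;
  subspaceP : forall a x y, subspace_set x -> subspace_set y ->
    subspace_set (a *: x + y) }.

Section SubspaceType.
Context (E : normedModType C) (V : subspace E).

Definition subspace_pred : {pred E} := fun x => x \in subspace_set V.

Let subspace_closed : subsemimod_closed subspace_pred.
Proof.
split; first split.
- by apply/mem_set; exact: subspace0.
- move=> x y /set_mem Vx /set_mem Vy; apply/mem_set.
  by rewrite -[x]scale1r; exact: subspaceP.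
- move=> a x /set_mem Vx; apply/mem_set.
  by rewrite -[_ *: _]addr0; apply: subspaceP => //; exact: subspace0.
Qed.

HB.instance Definition _ := GRing.isSubmodClosed.Build C E subspace_pred
  subspace_closed.

Definition subspace_type : Type := {x : E | subspace_pred x}.

HB.instance Definition _ := SubChoice.on subspace_type.
HB.instance Definition _ := [SubChoice_isSubLmodule of subspace_type by <:].

Let sub_normD (x y : subspace_type) : `|val (x + y)| <= `|val x| + `|val y|.
Proof. by rewrite raddfD ler_normD. Qed.
Let sub_normZ (a : C) (x : subspace_type) : `|val (a *: x)| = `|a| * `|val x|.
Proof. by rewrite linearZ normrZ. Qed.
Let sub_norm0 (x : subspace_type) : `|val x| = 0 -> x = 0.
Proof. by move=> /normr0_eq0 x0; apply: val_inj; rewrite x0 raddf0. Qed.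

HB.instance Definition _ := Lmodule_isNormed.Build C subspace_type
  sub_normD sub_normZ sub_norm0.

Lemma subspace_valP (x : subspace_type) : subspace_set V (val x).
Proof. exact/set_mem/(valP x). Qed.

Definition subspace_incl : blin subspace_type E.
Proof.
refine (@mkblin _ subspace_type E val _ _).
- by move=> a x y; rewrite linearP.
- by exists 1 => x; rewrite mul1r.
Defined.

End SubspaceType.

Section Restrict.
Context (E F : normedModType C) (V : subspace E) (W : subspace F) (T : blin E F).
Hypothesis TVW : forall x, subspace_set V x -> subspace_set W (T x).
Let restr_fun (x : subspace_type V) : subspace_type W :=
  exist _ (T (val x)) (mem_set (TVW (subspace_valP x))).
Definition blin_restrict : blin (subspace_type V) (subspace_type W).
Proof.
refine (@mkblin _ _ _ restr_fun _ _).
- by move=> a x y; apply: val_inj; rewrite /= !linearP.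
- by exists `|T| => x; exact: le_blin_norm.
Defined.
End Restrict.

Section Range.
Context (E F : normedModType C) (T : blin E F).
Definition range_subspace : subspace F.
Proof.
refine (@Subspace F (range T) _ _).
- by exists 0 => //; rewrite linear0.
- by move=> a _ _ [x _ <-] [y _ <-]; exists (a *: x + y) => //; rewrite linearP.
Defined.
End Range.

End Operators.

Coercion subspace_type : subspace >-> Sortclass.

Section Bimodules.
Context (R : realType).
Local Notation C := (R[i]).

Definition bilin (E F G : lmodType C) (op : E -> F -> G) : Prop :=
  (forall y, linear (op^~ y)) /\ (forall x, linear (op x)).

Definition bounded_bilin (E F G : normedModType C) (op : E -> F -> G) : Prop :=
  bilin op /\ exists k : C, forall x y, `|op x y| <= k * `|x| * `|y|.

Lemma bounded_bilin_ge0 (E F G : normedModType C) (op : E -> F -> G) :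
  bounded_bilin op ->
  exists2 k : C, 0 <= k & forall x y, `|op x y| <= k * `|x| * `|y|.
Proof.
move=> [_ [k kP]]; exists `|k| => // x y.
have k0 : 0 <= k * `|x| * `|y| by exact: le_trans (kP x y).
by rewrite (le_trans (kP x y))// -[leLHS]ger0_norm// !normrM !normr_id.
Qed.

Record is_banach_algebra (B : completeNormedModType C) (mul : B -> B -> B) :
    Prop := IsBanachAlgebra {
  ba_mulA : forall a b c, mul a (mul b c) = mul (mul a b) c;
  ba_bilin : bilin mul;
  ba_norm : forall a b, `|mul a b| <= `|a| * `|b| }.

Record banachAlg := BanachAlg {
  ba_sort :> completeNormedModType C;
  ba_mul : ba_sort -> ba_sort -> ba_sort;
  ba_axiom : is_banach_algebra ba_mul }.

Record is_bimodule (B : normedModType C) (mul : B -> B -> B)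
    (E : normedModType C) (l : B -> E -> E) (r : E -> B -> E) : Prop :=
  IsBimodule {
  bm_lbilin : bounded_bilin l;
  bm_rbilin : bounded_bilin r;
  bm_lA : forall a b x, l (mul a b) x = l a (l b x);
  bm_rA : forall x a b, r x (mul a b) = r (r x a) b;
  bm_lrA : forall a x b, r (l a x) b = l a (r x b) }.

(* The underlying space is only required to be normed; Banach bimodules are
   those whose underlying space is complete. *)
Record bimodule (B : normedModType C) (mul : B -> B -> B) := Bimodule {
  bm_sort :> normedModType C;
  lact : B -> bm_sort -> bm_sort;
  ract : bm_sort -> B -> bm_sort;
  bm_axiom : is_bimodule mul lact ract }.

Section Actions.
Context (B : normedModType C) (mul : B -> B -> B) (X : bimodule mul).
Let Xax := bm_axiom X.

Definition lact_blin (a : B) : blin X X.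
Proof.
refine (@mkblin _ X X (lact a) _ _).
- exact: (bm_lbilin Xax).1.2.
- by have [_ [k kP]] := bm_lbilin Xax; exists (k * `|a|) => x.
Defined.

Definition ract_blin (a : B) : blin X X.
Proof.
refine (@mkblin _ X X (fun x => ract x a) _ _).
- exact: (bm_rbilin Xax).1.1.
- have [_ [k kP]] := bm_rbilin Xax; exists (k * `|a|) => x.
  by rewrite mulrAC.
Defined.

Definition lorbit (x : X) : blin B X.
Proof.
refine (@mkblin _ B X (fun a => lact a x) _ _).
- exact: (bm_lbilin Xax).1.1.
- have [_ [k kP]] := bm_lbilin Xax; exists (k * `|x|) => a.
  by rewrite mulrAC.
Defined.

Definition rorbit (x : X) : blin B X.
Proof.
refine (@mkblin _ B X (ract x) _ _).
- exact: (bm_rbilin Xax).1.2.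
- by have [_ [k kP]] := bm_rbilin Xax; exists (k * `|x|) => a.
Defined.

(* (a . f)(x) = f(x . a) and (f . a)(x) = f(a . x). *)
Definition dual_lact (a : B) (f : dual X) : dual X := blin_comp f (ract_blin a).
Definition dual_ract (f : dual X) (a : B) : dual X := blin_comp f (lact_blin a).

Lemma dual_is_bimodule : is_bimodule mul dual_lact dual_ract.
Proof.
have [ll lr] := (bm_lbilin Xax).1; have [rl rr] := (bm_rbilin Xax).1.
have [k k0 kP] := bounded_bilin_ge0 (bm_lbilin Xax).
have [h h0 hP] := bounded_bilin_ge0 (bm_rbilin Xax).
split.
- split; first split.
  + by move=> f c a b; apply: blinP => x /=; rewrite (rr x) linearP.
  + by move=> a c f g; exact: blinP.
  + exists h => a f; apply: blin_norm_le => [|x]; first by rewrite !mulr_ge0.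
    apply: le_trans (le_blin_norm f (ract x a)) _.
    apply: le_trans (ler_wpM2l (normr_ge0 f) (hP x a)) _.
    by rewrite le_eqVlt; apply/orP; left; apply/eqP; ring.
- split; first split.
  + by move=> a c f g; exact: blinP.
  + by move=> f c a b; apply: blinP => x /=; rewrite (ll x) linearP.
  + exists k => f a; apply: blin_norm_le => [|x]; first by rewrite !mulr_ge0.
    apply: le_trans (le_blin_norm f (lact a x)) _.
    apply: le_trans (ler_wpM2l (normr_ge0 f) (kP a x)) _.
    by rewrite le_eqVlt; apply/orP; left; apply/eqP; ring.
- by move=> a b f; apply: blinP => x /=; rewrite (bm_rA Xax).
- by move=> f a b; apply: blinP => x /=; rewrite (bm_lA Xax).
- by move=> a f b; apply: blinP => x /=; rewrite (bm_lrA Xax).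
Qed.

Definition dual_bimodule : bimodule mul := Bimodule dual_is_bimodule.

End Actions.

Definition is_bimod_hom (B : normedModType C) (mul : B -> B -> B)
    (X Y : bimodule mul) (f : X -> Y) : Prop :=
  (forall a x, f (lact a x) = lact a (f x)) /\
  (forall x a, f (ract x a) = ract (f x) a).

Lemma adjoint_hom (B : normedModType C) (mul : B -> B -> B)
    (X Y : bimodule mul) (f : blin X Y) : is_bimod_hom f ->
  is_bimod_hom (X := dual_bimodule Y) (Y := dual_bimodule X) (adjoint f).
Proof.
move=> [fl fr]; split=> [a g|g a]; apply: blinP => x /=.
  by rewrite fr.
by rewrite fl.
Qed.

Section WAP.
Context (A : banachAlg).
Local Notation mul := (@ba_mul A).

Lemma regular_is_bimodule : is_bimodule mul mul mul.
Proof.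
have [mA mlin mnorm] := ba_axiom A.
have mb : bounded_bilin mul.
  by split=> //; exists 1 => x y; rewrite mul1r.
by split=> //.
Qed.

Definition regular : bimodule mul := Bimodule regular_is_bimodule.

Context (X : bimodule mul).
Let Xax := bm_axiom X.

Definition wap_set : set X := [set x |
  weakly_compact_map (fun a : A => lact a x) /\
  weakly_compact_map (fun a : A => ract x a)].

(* WAP_A(X); it is norm-closed, but this is not needed to form its dual. *)
Definition wap : subspace X.
Proof.
refine (@Subspace _ X wap_set _ _).
- have [l0 r0] : (fun a : A => lact a (0 : X)) = (fun=> 0) /\
      (fun a : A => ract (0 : X) a) = (fun=> 0).
    split; apply/funext => a; first exact: (linear0 (lact_blin X a)).
    exact: (linear0 (ract_blin X a)).
  by split; rewrite ?l0 ?r0; exact: weakly_compact_map0.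
- move=> c x y [lx rx] [ly ry]; split.
    have -> : (fun a : A => lact a (c *: x + y)) =
        (fun a => c *: lact a x + lact a y).
      by apply/funext => a; exact: (linearP (lact_blin X a)).
    exact: weakly_compact_mapP.
  have -> : (fun a : A => ract (c *: x + y) a) =
      (fun a => c *: ract x a + ract y a).
    by apply/funext => a; exact: (linearP (ract_blin X a)).
  exact: weakly_compact_mapP.
Defined.

Lemma wap_lact (a : A) (x : X) : wap_set x -> wap_set (lact_blin X a x).
Proof.
move=> [lx rx]; split.
  have -> : (fun b : A => lact b (lact_blin X a x)) =
      lorbit x \o ract_blin regular a.
    by apply/funext => b /=; rewrite (bm_lA Xax).
  exact: weakly_compact_map_precomp.
have -> : (fun b : A => ract (lact_blin X a x) b) =
    lact_blin X a \o rorbit x.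
  by apply/funext => b /=; rewrite (bm_lrA Xax).
exact: weakly_compact_map_comp.
Qed.

Lemma wap_ract (a : A) (x : X) : wap_set x -> wap_set (ract_blin X a x).
Proof.
move=> [lx rx]; split.
  have -> : (fun b : A => lact b (ract_blin X a x)) =
      ract_blin X a \o lorbit x.
    by apply/funext => b /=; rewrite (bm_lrA Xax).
  exact: weakly_compact_map_comp.
have -> : (fun b : A => ract (ract_blin X a x) b) =
    rorbit x \o lact_blin regular a.
  by apply/funext => b /=; rewrite (bm_rA Xax).
exact: weakly_compact_map_precomp.
Qed.

Definition wap_l (a : A) (x : wap) : wap :=
  blin_restrict (V := wap) (W := wap) (@wap_lact a) x.
Definition wap_r (x : wap) (a : A) : wap :=
  blin_restrict (V := wap) (W := wap) (@wap_ract a) x.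

Lemma wap_is_bimodule : is_bimodule mul wap_l wap_r.
Proof.
have [[ll lr] [k kP]] := bm_lbilin Xax; have [[rl rr] [h hP]] := bm_rbilin Xax.
split.
- split; first split.
  + move=> x c a b; apply: val_inj; rewrite linearP /=; exact: (ll (val x)).
  + by move=> a c x y; rewrite /wap_l linearP.
  + by exists k => a x; exact: (kP a (val x)).
- split; first split.
  + by move=> a c x y; rewrite /wap_r linearP.
  + move=> x c a b; apply: val_inj; rewrite linearP /=; exact: (rr (val x)).
  + by exists h => x a; exact: (hP (val x) a).
- by move=> a b x; apply: val_inj; exact: (bm_lA Xax).
- by move=> x a b; apply: val_inj; exact: (bm_rA Xax).
- by move=> a x b; apply: val_inj; exact: (bm_lrA Xax).
Qed.

Definition WAP : bimodule mul := Bimodule wap_is_bimodule.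

End WAP.

Lemma wap_hom (A : banachAlg) (X Y : bimodule (@ba_mul A)) (f : blin X Y) :
  is_bimod_hom f -> forall x, wap_set x -> wap_set (f x).
Proof.
move=> [fl fr] x [lx rx]; split.
  have -> : (fun a : A => lact a (f x)) = f \o lorbit x.
    by apply/funext => a /=; rewrite fl.
  exact: weakly_compact_map_comp.
have -> : (fun a : A => ract (f x) a) = f \o rorbit x.
  by apply/funext => a /=; rewrite fr.
exact: weakly_compact_map_comp.
Qed.

Section FA.
Context (A : banachAlg).
Local Notation mul := (@ba_mul A).

(* FA_pre X = F_A(X)_*, FA X = F_A(X). *)
Definition FA_pre (X : bimodule mul) : bimodule mul := WAP (dual_bimodule X).
Definition FA (X : bimodule mul) : bimodule mul := dual_bimodule (FA_pre X).

Definition FA_quot (X : bimodule mul) : blin (dual (dual X)) (FA X) :=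
  adjoint (subspace_incl (wap (dual_bimodule X))).

Definition FA_eta (X : bimodule mul) : blin X (FA X) :=
  blin_comp (FA_quot X) (bidual X).

Definition FA_map (X Y : bimodule mul) (f : blin X Y) (hf : is_bimod_hom f) :
    blin (FA X) (FA Y) :=
  adjoint (blin_restrict (V := wap (dual_bimodule Y))
    (W := wap (dual_bimodule X)) (wap_hom (adjoint_hom hf))).

End FA.
End Bimodules.

Section Connes.
Context (R : realType).
Local Notation C := (R[i]).

Section DualBanachAlgebra.
Context (B : completeNormedModType C) (mul : B -> B -> B).
Context (P : subspace (dual B)).

(* The natural map B -> B^** -> P^*. *)
Definition predual_map : blin B (dual P) :=
  blin_comp (adjoint (subspace_incl P)) (bidual B).

Record is_dual_banach_algebra : Prop := IsDualBanachAlgebra {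
  dba_alg : is_banach_algebra mul;
  dba_closed : closed (subspace_set P);
  (* P is a sub-bimodule of B^* :
     (b . f)(c) = f(cb) and (f . b)(c) = f(bc). *)
  dba_lact : forall b (f : P),
    exists g : P, forall c, val g c = val f (mul c b);
  dba_ract : forall (f : P) b,
    exists g : P, forall c, val g c = val f (mul b c);
  dba_bij : bijective predual_map }.

Definition predual_topology : Type :=
  sigma_topology (fun (b : B) (f : P) => val f b).
HB.instance Definition _ := Uniform.on predual_topology.

Definition normal_dual (E : bimodule mul) : Prop :=
  forall x : dual_bimodule E,
    continuous ((fun b => lact b x) : predual_topology -> weak_star E) /\
    continuous ((fun b => ract x b) : predual_topology -> weak_star E).

Definition derivation (X : bimodule mul) (D : B -> X) : Prop :=
  forall a b, D (mul a b) = lact a (D b) + ract (D a) b.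

Definition inner (X : bimodule mul) (D : B -> X) : Prop :=
  exists n : X, forall b, D b = lact b n - ract n b.

(* Connes-amenability is a property of dual Banach algebras, hence the first
   conjunct. *)
Definition connes_amenable : Prop :=
  is_dual_banach_algebra /\
  forall (E : completeNormedModType C) (l : B -> E -> E) (r : E -> B -> E)
      (El : is_bimodule mul l r),
    let M := dual_bimodule (Bimodule El) in
    normal_dual (Bimodule El) ->
    forall D : blin B M, derivation D ->
      continuous (D : predual_topology -> weak_star E) ->
      inner D.

End DualBanachAlgebra.

Section ArensProduct.
Context (A : banachAlg R).

(* (N . f)(a) = N(f . a). *)
Definition arens_lact (N : dual (dual A)) : blin (dual A) (dual A).
Proof.
refine (@mkblin _ (dual A) (dual A)
  (fun f => blin_comp N (rorbit (X := dual_bimodule (regular A)) f)) _ _).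
- move=> c f g; apply: blinP => a.
  exact: (linearP (blin_comp N (ract_blin (dual_bimodule (regular A)) a))).
- exists `|N| => f; apply: blin_norm_le => [|a]; first by rewrite mulr_ge0.
  apply: le_trans (le_blin_norm N _) _.
  rewrite -mulrA ler_wpM2l//; apply: blin_norm_le => [|b].
    by rewrite mulr_ge0.
  apply: le_trans (le_blin_norm f _) _; rewrite -mulrA ler_wpM2l//.
  exact: (ba_norm (ba_axiom A)).
Defined.

(* The first Arens product, (M arens N)(f) = M(N . f). *)
Definition arens (M N : dual (dual A)) : dual (dual A) :=
  blin_comp M (arens_lact N).

(* The Banach space F(A). *)
Definition FAalg : completeNormedModType C := dual (FA_pre (regular A)).

(* The product of F(A) is computed on representatives in A^**.  The quotient
   map is onto (Hahn-Banach) and its kernel is an ideal for the first Arens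
   product, so this is the only product making the quotient map
   multiplicative. *)
Definition FA_lift (b : FAalg) : dual (dual A) :=
  get [set M | FA_quot (regular A) M = b].

Definition FAalg_mul (b c : FAalg) : FAalg :=
  FA_quot (regular A) (arens (FA_lift b) (FA_lift c)).

(* The copy of WAP_A(A^* ) inside F(A)^* = WAP_A(A^* )^**. *)
Definition FAalg_predual : subspace (dual FAalg) :=
  range_subspace (bidual (FA_pre (regular A))).

End ArensProduct.

(* The projective tensor product, by its isometric universal property: it is
   unique up to isometric isomorphism. *)
Record projTensor (E F : completeNormedModType C) := ProjTensor {
  pt_sort :> completeNormedModType C;
  pt_tens : E -> F -> pt_sort;
  pt_bilin : bilin pt_tens;
  pt_norm : forall x y, `|pt_tens x y| <= `|x| * `|y|;
  pt_univ : forall (G : completeNormedModType C) (f : E -> F -> G) (k : C),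
    bilin f -> 0 <= k -> (forall x y, `|f x y| <= k * `|x| * `|y|) ->
    exists g : blin pt_sort G,
      [/\ forall x y, g (pt_tens x y) = f x y, `|g| <= k &
          forall h : blin pt_sort G,
            (forall x y, h (pt_tens x y) = f x y) -> h = g] }.

Section Lift.
Context (E F G : completeNormedModType C) (T : projTensor E F).

Lemma pt_ext (g h : blin T G) :
  (forall x y, g (pt_tens T x y) = h (pt_tens T x y)) -> g = h.
Proof.
move=> gh; have [tl tr] := pt_bilin T.
have [||x y|w [_ _ wu]] :=
  @pt_univ _ _ T G (fun x y => h (pt_tens T x y)) `|h|.
- split=> [y|x] c u v /=; first by rewrite (tl y) linearP.
  by rewrite (tr x) linearP.
- by [].
- apply: le_trans (le_blin_norm h _) _.
  by rewrite -mulrA ler_wpM2l//; exact: pt_norm.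
- by rewrite (wu g gh) (wu h).
Qed.

Lemma pt_lift_ex (f : E -> F -> G) : bounded_bilin f ->
  exists g : blin T G, forall x y, g (pt_tens T x y) = f x y.
Proof.
move=> bf; have [k k0 kP] := bounded_bilin_ge0 bf.
by have [g [gE _ _]] := pt_univ T bf.1 k0 kP; exists g.
Qed.

Definition pt_lift (f : E -> F -> G) (bf : bounded_bilin f) : blin T G :=
  projT1 (cid (pt_lift_ex bf)).

Lemma pt_liftE (f : E -> F -> G) (bf : bounded_bilin f) x y :
  pt_lift bf (pt_tens T x y) = f x y.
Proof. by rewrite /pt_lift; case: cid. Qed.

Lemma pt_lift_norm (f : E -> F -> G) (bf : bounded_bilin f) (k : C) :
  0 <= k -> (forall x y, `|f x y| <= k * `|x| * `|y|) -> `|pt_lift bf| <= k.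
Proof.
move=> k0 kP; have [g [gE gk gu]] := pt_univ T bf.1 k0 kP.
by rewrite (gu _ (pt_liftE bf)).
Qed.

End Lift.

Section TensorBimodule.
Context (A : banachAlg R) (T : projTensor A A).
Local Notation mul := (@ba_mul R A).
Local Notation "a '(x)' b" := (pt_tens T a b) (at level 40).
Let Aax := ba_axiom A.

Let tl_le (a b c : A) : `|mul a b (x) c| <= `|a| * `|b| * `|c|.
Proof.
apply: le_trans (pt_norm T _ _) _.
by rewrite ler_wpM2r//; exact: (ba_norm Aax).
Qed.

Let tr_le (a b c : A) : `|b (x) mul c a| <= `|a| * `|b| * `|c|.
Proof.
apply: le_trans (pt_norm T _ _) _.
apply: le_trans (ler_wpM2l (normr_ge0 b) (ba_norm Aax c a)) _.
by rewrite le_eqVlt; apply/orP; left; apply/eqP; ring.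
Qed.

Let tl_bilin (a : A) : bounded_bilin (fun b c => mul a b (x) c).
Proof.
have [[ml mr] [tl tr]] := (ba_bilin Aax, pt_bilin T).
split; last by exists `|a| => b c; exact: tl_le.
by split=> [c|b] k x y /=; [rewrite (mr a) (tl c)|rewrite (tr (mul a b))].
Qed.

Let tr_bilin (a : A) : bounded_bilin (fun b c => b (x) mul c a).
Proof.
have [[ml mr] [tl tr]] := (ba_bilin Aax, pt_bilin T).
split; last by exists `|a| => b c; exact: tr_le.
by split=> [c|b] k x y /=; [rewrite (tl (mul c a))|rewrite (ml a) (tr b)].
Qed.

Definition tensor_lact (a : A) (u : T) : T := pt_lift T (tl_bilin a) u.
Definition tensor_ract (u : T) (a : A) : T := pt_lift T (tr_bilin a) u.

Lemma tensor_lactE a b c : tensor_lact a (b (x) c) = mul a b (x) c.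
Proof. exact: pt_liftE. Qed.
Lemma tensor_ractE b c a : tensor_ract (b (x) c) a = b (x) mul c a.
Proof. exact: pt_liftE. Qed.

Lemma tensor_is_bimodule : is_bimodule mul tensor_lact tensor_ract.
Proof.
have [[ml mr] [tl tr]] := (ba_bilin Aax, pt_bilin T).
pose L a := pt_lift T (tl_bilin a); pose Q a := pt_lift T (tr_bilin a).
have LE a b c : L a (b (x) c) = mul a b (x) c by exact: pt_liftE.
have QE a b c : Q a (b (x) c) = b (x) mul c a by exact: pt_liftE.
split.
- split; first split.
  + move=> u k a b; rewrite /tensor_lact -/(L _) -/(L _) -/(L _).
    suff -> : L (k *: a + b) = k *: L a + L b by [].
    by apply: pt_ext => x y; rewrite blinDE blinZE !LE (ml x) (tl y).
  + by move=> a k u v; rewrite /tensor_lact linearP.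
  + exists 1 => a u; rewrite mul1r; apply: le_trans (le_blin_norm _ u) _.
    by rewrite ler_wpM2r//; apply: pt_lift_norm => // b c; exact: tl_le.
- split; first split.
  + by move=> a k u v; rewrite /tensor_ract linearP.
  + move=> u k a b; rewrite /tensor_ract -/(Q _) -/(Q _) -/(Q _).
    suff -> : Q (k *: a + b) = k *: Q a + Q b by [].
    by apply: pt_ext => x y; rewrite blinDE blinZE !QE (mr y) (tr x).
  + exists 1 => u a; rewrite mul1r mulrC; apply: le_trans (le_blin_norm _ u) _.
    by rewrite ler_wpM2r//; apply: pt_lift_norm => // b c; exact: tr_le.
- move=> a b u; suff e : L (mul a b) = blin_comp (L a) (L b).
    exact: (congr1 (fun h : blin T T => h u) e).
  by apply: pt_ext => x y; rewrite /= !LE (ba_mulA Aax).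
- move=> u a b; suff e : Q (mul a b) = blin_comp (Q b) (Q a).
    exact: (congr1 (fun h : blin T T => h u) e).
  by apply: pt_ext => x y; rewrite /= !QE (ba_mulA Aax).
- move=> a u b; suff e : blin_comp (Q b) (L a) = blin_comp (L a) (Q b).
    exact: (congr1 (fun h : blin T T => h u) e).
  by apply: pt_ext => x y; rewrite /= !(LE, QE).
Qed.

Definition tensor_bimodule : bimodule mul := Bimodule tensor_is_bimodule.

Let mul_bilin : bounded_bilin mul.
Proof.
split; first exact: (ba_bilin Aax).
by exists 1 => x y; rewrite mul1r; exact: (ba_norm Aax).
Qed.

Definition Delta : blin tensor_bimodule (regular A) := pt_lift T mul_bilin.

Lemma Delta_hom : is_bimod_hom Delta.
Proof.
have DE x y : Delta (x (x) y) = mul x y by exact: pt_liftE.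
split.
- move=> a u; suff e : blin_comp Delta (lact_blin tensor_bimodule a) =
      blin_comp (lact_blin (regular A) a) Delta.
    exact: (congr1 (fun h : blin T A => h u) e).
  apply: pt_ext => x y /=.
  by rewrite tensor_lactE DE [X in _ = mul _ X]DE (ba_mulA Aax).
- move=> u a; suff e : blin_comp Delta (ract_blin tensor_bimodule a) =
      blin_comp (ract_blin (regular A) a) Delta.
    exact: (congr1 (fun h : blin T A => h u) e).
  apply: pt_ext => x y /=.
  by rewrite tensor_ractE DE [X in _ = mul X _]DE (ba_mulA Aax).
Qed.

Definition Delta_WAP : blin (FA tensor_bimodule) (FA (regular A)) :=
  FA_map Delta_hom.

Definition wap_virtual_diagonal (m : FA tensor_bimodule) : Prop :=
  (forall a : A, lact a m = ract m a) /\
  (forall a : A, ract (Delta_WAP m) a = FA_eta (regular A) a).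

End TensorBimodule.
End Connes.

(* Main.v *)
Require Import Defs.
From HB Require Import structures.
From mathcomp Require Import all_boot all_order all_algebra.
From mathcomp Require Import complex ring lra.
From mathcomp Require Import all_classical all_reals all_analysis.

Set Implicit Arguments.
Unset Strict Implicit.
Unset Printing Implicit Defensive.

Import Order.TTheory GRing.Theory Num.Theory.
Import numFieldNormedType.Exports.

Local Open Scope classical_set_scope.
Local Open Scope complex_scope.
Local Open Scope ring_scope.

(* Write W(X) = WAP_A(X^* ).  A bounded map T : E -> X^* is weakly compact iff
   the two Arens extensions of the form T a x to E^** x X^** agree.  Goldstine's
   theorem and the compactness of dual balls give this, and also lift
   functionals on a subspace of a dual to the bidual, so that the Hahn-Banach
   theorem is never needed.  Interchanging iterated limits then makes W(X) an
   F(A)-bimodule whose dual F_A(X) is normal.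

   If F(A) is Connes-amenable it has a unit e.  Let n in F_A(A (x) A) be the
   image of e (x) e; then Delta_WAP n = e, and c |-> c.n - n.c is a derivation
   into the kernel of Delta_WAP, which embeds in a normal dual bimodule.  It is
   inner there, and correcting n accordingly gives a virtual diagonal.

   Conversely, let m be a virtual diagonal and D a weak*-continuous derivation
   into a normal dual E^*.  The functional F_y (a (x) b) = <a.D b, y> is in
   W(A (x) A), and x : y |-> m(F_y) satisfies e.D b = b.x - x.b, where
   e = Delta_WAP m is the unit of F(A); D is then inner by algebra. *)

(** * Ultrafilters, weak topologies and compactness of dual balls *)

Lemma ultra_map (T U : Type) (f : T -> U) (F : set_system T) :
  UltraFilter F -> UltraFilter (f @ F).
Proof.
move=> FU; split=> [|G GF sFG]; first exact: fmap_proper_filter.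
rewrite predeqE => A; split; last exact: sFG.
move=> GA; have [//|FnA] := in_ultra_setVsetC (f @^-1` A) FU.
have GnA : G (~` A) by exact: sFG.
by have /filter_ex[? []] : G (A `&` ~` A) by exact: filterI.
Qed.

Lemma initial_cvg (S : choiceType) (T : topologicalType) (f : S -> T)
    (F : set_system S) (s : S) : Filter F ->
  f @ F --> f s -> F --> (s : initial_topology f).
Proof.
move=> FF Ff A [_ [[B Bop <-] Bs sBA]]; apply: filterS sBA _.
by apply: Ff; exact: open_nbhs_nbhs.
Qed.

Section SigmaTopology.
Context (R : realType).
Local Notation C := (R[i]).

Lemma sigma_cvg (T : choiceType) (I : Type) (p : T -> I -> C)
    (F : set_system T) (s : T) : Filter F ->
  (forall i, (fun x => p x i) @ F --> p s i) -> F --> (s : sigma_topology p).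
Proof.
move=> FF Fp; apply: initial_cvg; apply/cvg_sup => i.
exact: (@initial_cvg (prod_topology (fun _ : I => C)) C (fun g => g i)
  (p @ F) (p s) _ (Fp i)).
Qed.

(** Real and imaginary parts carry an ultrafilter on the disc to ultrafilters on a compact segment,
    and the two limits are the parts of its limit. *)
Lemma closed_disc_compact (r : C) : compact [set z : C | `|z| <= r].
Proof.
rewrite compact_ultra => F FU Fr.
(* The order on [C] is partial, so [r] may be negative or not real; the disc is then empty. *)
have [r0|nr0] := boolP (0 <= r); last first.
  have [z /= zr] := filter_ex Fr.
  by rewrite (le_trans _ zr) in nr0.
have rE := ge0_ReE r0.
have cF (p : C -> R) : (forall z : C, `|p z|%:C <= `|z|) ->
    exists l : R, p @ F --> l.
  move=> ple; have pU := @ultra_map _ _ p F FU.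
  have := @segment_compact R (- complex.Re r) (complex.Re r).
  rewrite compact_ultra => /(_ _ pU)[].
    apply: (filterS (P := [set z : C | `|z| <= r])) Fr => z /= zr.
    rewrite in_itv/= -ler_norml -lecR -rE; exact: le_trans (ple z) zr.
  by move=> l [_ ?]; exists l.
have [a Ha] := cF _ (@normc_ge_Re R).
have [b Hb] := cF _ (@normC_ge_Im R).
have Fl : F --> (a +i* b : C).
  apply/cvgrPdist_lt => e e0.
  have eR : e = (complex.Re e)%:C by exact/ge0_ReE/ltW.
  have e'0 : 0 < complex.Re e by rewrite eR ltcR in e0.
  have e20 : 0 < complex.Re e / 2 by rewrite divr_gt0.
  move/cvgrPdist_lt : Ha => /(_ _ e20) Ha.
  move/cvgrPdist_lt : Hb => /(_ _ e20) Hb.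
  near=> z; apply: (le_lt_trans (normC_le_Re_Im _)).
  rewrite eR ltcR [ltRHS]splitr; apply: ltrD.
    have -> : complex.Re (a +i* b - z) = a - complex.Re z by case: (z).
    by near: z; exact: Ha.
  have -> : complex.Im (a +i* b - z) = b - complex.Im z by case: (z).
  by near: z; exact: Hb.
exists (a +i* b); split=> //=.
apply/ler_addgt0Pr => e e0; move/cvgrPdist_lt : Fl => /(_ _ e0) Fl.
near F => z; rewrite -[a +i* b](subrK z) addrC (le_trans (ler_normD _ _))//.
by rewrite lerD//; [near: z|apply/ltW; near: z].
Unshelve. all: by end_near. Qed.

(** Banach-Alaoglu: along an ultrafilter on the ball the values at [x] converge in the disc of
    radius [r * |x|], and the pointwise limit is linear with the same bound. *)
Lemma weak_star_ball_compact (E : normedModType C) (r : C) :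
  compact ([set f : dual E | `|f| <= r] : set (weak_star E)).
Proof.
have [r0|nr0] := boolP (0 <= r); last first.
  have -> : [set f : dual E | `|f| <= r] = set0.
    by apply/seteqP; split=> // f /= fr; rewrite (le_trans _ fr) in nr0.
  exact: compact0.
rewrite compact_ultra => F FU Fr.
have /choice[g gP] x :
    exists l : C, (fun f : dual E => f x) @ F --> l /\ `|l| <= r * `|x|.
  have pU := @ultra_map _ _ (fun f : dual E => f x) F FU.
  have := @closed_disc_compact (r * `|x|); rewrite compact_ultra => /(_ _ pU)[].
    apply: (filterS (P := [set f : dual E | `|f| <= r])) Fr => f /= fr.
    apply: le_trans (le_blin_norm f x) _.
    by rewrite ler_wpM2r.
  by move=> l [? ?]; exists l.
have glin : linear g.
  move=> a x y; have := (gP (a *: x + y)).1.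
  have -> : (fun f : dual E => f (a *: x + y)) = (fun f => a *: f x + f y).
    by apply/funext => f; rewrite linearP.
  move=> Fxy; apply: (cvg_unique _ Fxy); first exact: norm_hausdorff.
  by apply: cvgD; [apply: cvgZ; [exact: cvg_cst|exact: (gP _).1]|exact: (gP _).1].
pose g' : dual E := @mkblin _ E C g glin (ex_intro _ r (fun x => (gP x).2)).
exists g'; split; first by apply: blin_norm_le => // x; exact: (gP x).2.
by apply: sigma_cvg => x; exact: (gP x).1.
Qed.

End SigmaTopology.

(** * Goldstine's theorem *)

Section Goldstine.
Context (R : realType).
Local Notation C := (R[i]).

Lemma Re_le_norm (z : C) : (complex.Re z)%:C <= `|z|.
Proof. by apply: le_trans (normc_ge_Re z); rewrite lecR ler_norm. Qed.

(** Each [x] with [f x] nonzero has a multiple [b] of norm at most [r] at which [f b] is the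
    nonnegative real [r * |f x| / |x|], so a bound for real parts is a bound for moduli. *)
Lemma norm_le_of_Re (E : normedModType C) (f : dual E) (r : C) (k : R) :
  0 < r -> (forall b, `|b| <= r -> complex.Re (f b) <= k) -> r * `|f| <= k%:C.
Proof.
move=> r0 fk.
have k0 : 0 <= k%:C.
  by rewrite lecR; have := fk 0; rewrite linear0 normr0 => -> //; exact: ltW.
rewrite mulrC -ler_pdivlMr//.
apply: blin_norm_le => [|x]; first by rewrite divr_ge0// ltW.
have [->|x0] := eqVneq x 0; first by rewrite linear0 !normr0 mulr0.
have [->|z0] := eqVneq (f x) 0; first by rewrite normr0 mulr_ge0// divr_ge0// ltW.
have nx : 0 < `|x| by rewrite normr_gt0.
have nz : 0 < `|f x| by rewrite normr_gt0.
pose b := (r / `|x| * (`|f x| / f x)) *: x.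
have bE : f b = r / `|x| * `|f x|.
  by rewrite linearZ /= -[_ *: _]/(_ * _) -!mulrA mulVf// mulr1.
have br : `|b| <= r.
  rewrite normrZ !normrM !normfV !normr_id mulfV ?gt_eqF// mulr1.
  by rewrite -mulrA mulVf ?gt_eqF// mulr1 gtr0_norm.
have fb0 : 0 <= f b by rewrite bE mulr_ge0// divr_ge0// ltW.
have := fk b br; rewrite -lecR -(ge0_ReE fb0) bE => h.
have rx : 0 < r / `|x| by rewrite divr_gt0.
rewrite -(ler_pM2l rx); apply: le_trans h _; rewrite le_eqVlt; apply/orP; left.
by apply/eqP; field; rewrite !gt_eqF.
Qed.

(** The Euclidean inner product of the plane; it keeps the function to be minimised in [R]. *)
Let ip (u w : C) : R := complex.Re u * complex.Re w + complex.Im u * complex.Im w.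

Let ip_conjc u w : ip u w = complex.Re (conjc u * w).
Proof. by case: u w => a b [c d]; rewrite /ip /=; ring. Qed.

Let ip_ge0 u : 0 <= ip u u.
Proof. by rewrite /ip -!expr2 addr_ge0 ?sqr_ge0. Qed.

Let ip_norm u : (ip u u)%:C = `|u| ^+ 2.
Proof.
case: u => a b; rewrite normc_def/= -rmorphXn/= sqr_sqrtr ?addr_ge0 ?sqr_ge0//.
Qed.

Let ip_expand u w (t : R) :
  ip (u - t%:C * w) (u - t%:C * w) = ip u u - 2 * t * ip u w + t ^+ 2 * ip w w.
Proof. by case: u w => a b [c d]; rewrite /ip /=; ring. Qed.

Let Re_sum (I : Type) (s : seq I) (F : I -> C) :
  complex.Re (\sum_(i <- s) F i) = \sum_(i <- s) complex.Re (F i).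
Proof. exact: (raddf_sum (@complex.Re R)). Qed.

(* Minimise the sum of the squares of c v - i v a over the ball: the first order
   condition at a near-minimiser a, tested on lambda = sum of conj (c v - i v a) v,
   says that i lambda almost attains its norm at a, and then c lambda - i lambda a,
   which is the minimum, is almost nonpositive. *)
Lemma goldstine (E V : normedModType C) (i : blin V (dual E)) (c : dual V)
    (r : C) : 0 < r -> (forall v, `|c v| <= r * `|i v|) ->
  forall (s : seq V) (e : R), 0 < e ->
  exists2 a : E, `|a| <= r & forall v, v \in s -> `|c v - i v a| < e%:C.
Proof.
move=> r0 cr s.
pose N a := \sum_(v <- s) ip (c v - i v a) (c v - i v a).
have N0 a : 0 <= N a by exact: sumr_ge0.
pose S := N @` [set a | `|a| <= r].
have hS : has_inf S.
  split; first by exists (N 0), 0 => //=; rewrite normr0 ltW.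
  by exists 0 => _ [a _ <-].
(* [K] bounds the second order term of [N] between two points of the ball, which are at distance at
   most [r + r]. *)
pose K := \sum_(v <- s) complex.Re ((`|i v| * (r + r)) ^+ 2).
have wK a b : `|a| <= r -> `|b| <= r ->
    \sum_(v <- s) ip (i v (b - a)) (i v (b - a)) <= K.
  move=> ar br; apply: ler_sum => v _.
  have n0 : 0 <= `|i v| * (r + r) by rewrite mulr_ge0// addr_ge0 ?ltW.
  rewrite -lecR ip_norm -ge0_ReE ?exprn_ge0// lerXn2r ?nnegrE//.
  apply: le_trans (le_blin_norm _ _) _; rewrite ler_wpM2l//.
  by rewrite (le_trans (ler_normB _ _))// lerD.
(* The point [a] is within [t ^+ 2] of the infimum and is compared with a step of length [t] towards
   [b]; dividing the inequality by [2 * t] leaves an error linear in [t]. *)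
have d0 (t : R) : 0 < t -> t < 1 -> inf S <= t * ((1 + K) / 2).
  move=> t0 t1; have t20 : 0 < t ^+ 2 by rewrite exprn_gt0.
  have [_ [a /= ar <-] Na] := inf_adherent t20 hS.
  pose u v := c v - i v a.
  pose l := \sum_(v <- s) conjc (u v) *: v.
  have lE : complex.Re (c l - i l a) = N a.
    rewrite /l !linear_sum/= [X in _ - X](_ : _ = \sum_(v <- s) conjc (u v) * i v a).
      rewrite -sumrB Re_sum; apply: eq_bigr => v _.
      by rewrite linearZ/= -[_ *: _]/(_ * _) -mulrBr ip_conjc.
    by elim: (s) => [|v s' IH]; rewrite ?big_nil// !big_cons blinDE IH linearZ.
  have Hb b : `|b| <= r -> complex.Re (i l b) <= complex.Re (i l a) + t * ((1 + K) / 2).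
    move=> br.
    have ar' : `|a + t%:C *: (b - a)| <= r.
      have -> : a + t%:C *: (b - a) = (1 - t)%:C *: a + t%:C *: b.
        by rewrite scalerBr rmorphB/= scalerBl scale1r addrA addrAC.
      have t0C : 0 <= t%:C by rewrite lecR ltW.
      have t1C : 0 <= (1 - t)%:C by rewrite lecR subr_ge0 ltW.
      rewrite (le_trans (ler_normD _ _))// !normrZ !ger0_norm//.
      apply: le_trans (lerD (ler_wpM2l t1C ar) (ler_wpM2l t0C br)) _.
      by rewrite -mulrDl -rmorphD/= subrK mul1r.
    have Sa' : inf S <= N (a + t%:C *: (b - a)).
      by apply: ge_inf; [case: hS|exists (a + t%:C *: (b - a))].
    have ilE : complex.Re (i l (b - a)) = \sum_(v <- s) ip (u v) (i v (b - a)).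
      have -> : i l (b - a) = \sum_(v <- s) conjc (u v) * i v (b - a).
        rewrite /l linear_sum/=.
        by elim: (s) => [|v s' IH]; rewrite ?big_nil// !big_cons blinDE IH linearZ.
      by rewrite Re_sum; apply: eq_bigr => v _; rewrite ip_conjc.
    have NE : N (a + t%:C *: (b - a)) = N a - 2 * t * complex.Re (i l (b - a)) +
        t ^+ 2 * \sum_(v <- s) ip (i v (b - a)) (i v (b - a)).
      rewrite ilE !mulr_sumr -sumrB -big_split/=; apply: eq_bigr => v _.
      rewrite -ip_expand linearD linearZ/= -[_ *: _]/(_ * _) opprD addrA//.
    have W := wK a b ar br.
    rewrite NE in Sa'.
    have -> : complex.Re (i l b) = complex.Re (i l a) + complex.Re (i l (b - a)).
      by rewrite -raddfD/= -linearD/= addrC subrK.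
    rewrite lerD2l; move: W Sa' Na t0.
    move: (inf S) (N a) (complex.Re _) (\sum_(_ <- _) _) => d n x w wK' dn nd t0'.
    rewrite -(ler_pM2l t0'); nra.
  have rl := norm_le_of_Re r0 Hb.
  have : N a <= t * ((1 + K) / 2).
    rewrite -lE raddfB/= lerBlDl -lecR.
    apply: le_trans (Re_le_norm _) _; apply: le_trans (cr l) _; exact: rl.
  by apply: le_trans; apply: ge_inf; [case: hS|exists a].
have K0 : 0 <= K.
  apply: sumr_ge0 => v _; rewrite -lecR -ge0_ReE ?exprn_ge0//;
  by rewrite mulr_ge0// addr_ge0 ?ltW.
have S0 : inf S <= 0.
  rewrite leNgt; apply/negP => d1.
  (* The second bound turns [d0] into [inf S <= inf S / 2]; the first keeps [t < 1]. *)
  pose t := Num.min (1 / 2) (inf S / (2 * ((1 + K) / 2))).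
  have k0 : 0 < (1 + K) / 2 by rewrite divr_gt0// ltr_pwDl.
  have t0 : 0 < t by rewrite lt_min divr_gt0//= divr_gt0// mulr_gt0.
  have t1 : t < 1 by rewrite gt_min; apply/orP; left; lra.
  have := d0 t t0 t1.
  have : t <= inf S / (2 * ((1 + K) / 2)) by rewrite ge_min lexx orbT.
  rewrite ler_pdivlMr ?mulr_gt0//; move: ((1 + K) / 2) (inf S) d1 => k d; nra.
move=> e e0.
have e20 : 0 < e ^+ 2 by rewrite exprn_gt0.
have [_ [a /= ar <-] Na] := inf_adherent e20 hS.
exists a => // v vs.
have : ip (c v - i v a) (c v - i v a) < e ^+ 2.
  apply: le_lt_trans (_ : N a < _); last by rewrite (lt_le_trans Na)// gerDr.
  rewrite /N (big_rem v vs)/= lerDl sumr_ge0//.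
rewrite -ltcR ip_norm rmorphXn/= ltr_pXn2r ?nnegrE//.
by rewrite lecR ltW.
Qed.

End Goldstine.

(** * Arens regularity and weak compactness *)

Section Regularity.
Context (R : realType).
Local Notation C := (R[i]).

Definition blin_id (E : normedModType C) : blin E E.
Proof.
refine (@mkblin _ E E id _ _) => //.
by exists 1 => x; rewrite mul1r.
Defined.

(** The approximants of [goldstine], indexed by a list and a tolerance, form a filter base; an
    ultrafilter that refines it makes all the values converge at once. *)
Lemma goldstine_ultra (E V : normedModType C) (i : blin V (dual E))
    (c : dual V) (r : C) : 0 < r -> (forall v, `|c v| <= r * `|i v|) ->
  exists F : set_system E, [/\ UltraFilter F, F [set a | `|a| <= r] &
    forall v, (fun a => i v a) @ F --> c v].
Proof.
move=> r0 cr.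
pose g (p : seq V * R) : set E := [set a | `|a| <= r /\
  forall v, v \in p.1 -> `|c v - i v a| < p.2%:C].
pose G := filter_from [set p : seq V * R | 0 < p.2] g.
have GF : ProperFilter G.
  apply: filter_from_proper; first apply: filter_from_filter.
  - by exists ([::], 1) => /=.
  - move=> [s d] [t e] /= d0 e0; exists (s ++ t, Num.min d e).
      by rewrite /= lt_min d0.
    move=> a [ar sta]; split; split=> // v vs.
      apply: lt_le_trans (sta v _) _; first by rewrite mem_cat vs.
      by rewrite lecR/= ge_min lexx.
    apply: lt_le_trans (sta v _) _; first by rewrite mem_cat vs orbT.
    by rewrite lecR/= ge_min lexx orbT.
  - move=> [s e] /= e0; have [a ar sa] := goldstine r0 cr s e0.
    by exists a.
have [F [FU GF']] := ultraFilterLemma GF.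
exists F; split=> // [|v].
  by apply: GF'; exists ([::], 1) => //= a [].
apply/cvgrPdist_lt => e e0; apply: GF'.
have eR : e = (complex.Re e)%:C by exact/ge0_ReE/ltW.
exists ([:: v], complex.Re e) => /=; first by rewrite -ltcR -eR.
by move=> a [_ /(_ v)]; rewrite mem_head -eR => -> .
Qed.

(* Replaces the Hahn-Banach theorem. *)
Lemma bidual_lift (E V : normedModType C) (i : blin V (dual E)) (c : dual V) :
  (forall v, `|v| <= `|i v|) ->
  exists M : dual (dual E), forall v, M (i v) = c v.
Proof.
(* The norm of [c] may vanish while the radius must be positive. The functional sought is a weak*
   limit, in the bidual ball, of the approximating points. *)
move=> vi; have r0 : 0 < `|c| + 1 by rewrite ltr_wpDl.
have [||F [FU Fr Fc]] := @goldstine_ultra _ _ i c (`|c| + 1) => // [v|].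
  rewrite (le_trans (le_blin_norm c v))// ler_pM// lerDl//.
have bU := @ultra_map _ _ (bidual E) F FU.
have := @weak_star_ball_compact R (dual E) (`|c| + 1).
rewrite compact_ultra => /(_ _ bU)[].
  apply: (filterS (P := [set a : E | `|a| <= `|c| + 1])) Fr => a /= ar.
  apply: le_trans ar; apply: blin_norm_le => // f.
  by rewrite mulrC; exact: (le_blin_norm f a).
move=> M [_ /= FM]; exists M => v.
apply: (cvg_unique _ _ (Fc v)); first exact: norm_hausdorff.
exact: (cvg_comp _ _ FM
  (@sigma_eval_continuous _ _ _ (fun (N : dual (dual E)) f => N f) (i v) M)).
Qed.

(** The Banach adjoint of [T] restricted to [X], so that [transpose T x a = T a x]. *)
Definition transpose (E X : normedModType C) (T : blin E (dual X)) :
    blin X (dual E) := blin_comp (adjoint T) (bidual X).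

Lemma transposeK (E X : normedModType C) (T : blin E (dual X)) :
  transpose (transpose T) = T.
Proof. by apply: blinP => a; exact: blinP. Qed.

(* The two Arens extensions of the bilinear form (a, x) |-> T a x to the
   biduals agree. *)
Definition arens_regular (E X : normedModType C) (T : blin E (dual X)) : Prop :=
  forall (M : dual (dual E)) (N : dual (dual X)),
    N (adjoint (transpose T) M) = M (adjoint T N).

Lemma arens_regular_transpose (E X : normedModType C) (T : blin E (dual X)) :
  arens_regular T -> arens_regular (transpose T).
Proof. by move=> rT N M; rewrite transposeK rT. Qed.

(** After scaling, [M] is a weak* limit of points of the unit ball along an ultrafilter, and their
    images have a weak limit [g]. Every [N'] takes at [g] the value [M (adjoint T N')]; evaluations
    at points of [X] identify [g] with [adjoint (transpose T) M]. *)
Lemma weakly_compact_regular (E X : normedModType C) (T : blin E (dual X)) :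
  weakly_compact_map T -> arens_regular T.
Proof.
move=> /precompact_sub_compact[K Kco TK].
suff H (M : dual (dual E)) (N : dual (dual X)) : (forall f, `|M f| <= 1 * `|f|) ->
    N (adjoint (transpose T) M) = M (adjoint T N).
  move=> M N; have r0 : 0 < `|M| + 1 by rewrite ltr_wpDl.
  have := H ((`|M| + 1)^-1 *: M) N; rewrite !linearZ /= => HM.
  apply: (scalerI (invr_neq0 (lt0r_neq0 r0))); apply: HM => f.
  rewrite mul1r normrZ gtr0_norm ?invr_gt0// ler_pdivrMl//.
  by rewrite (le_trans (le_blin_norm M f))// ler_pM// lerDl.
move=> M1.
have [||F [FU F1 Fc]] := @goldstine_ultra _ _ (blin_id (dual E)) M 1 => //.
have TU := @ultra_map _ _ T F FU.
move: (Kco); rewrite compact_ultra => /(_ _ TU)[].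
  apply: (filterS (P := [set a : E | `|a| <= 1])) F1 => a /= a1.
  by apply: TK; exists a.
move=> g [_ /= Fg].
have gN (N' : dual (dual X)) : N' g = M (adjoint T N').
  apply: (cvg_unique _ _ (Fc (adjoint T N'))); first exact: norm_hausdorff.
  exact: (cvg_comp _ _ Fg (@weak_eval_continuous _ _ N' g)).
rewrite -gN; congr (N _); apply: blinP => x.
by have /= <- := gN (bidual X x).
Qed.

(** Regularity says that this map is weak*-to-weak continuous, and the unit ball of the bidual is
    weak* compact. *)
Lemma regular_weakly_compact_adjoint (E X : normedModType C)
    (T : blin E (dual X)) : arens_regular T ->
  weakly_compact_map (adjoint (transpose T)).
Proof.
move=> rT; apply/precompact_sub_compact.
exists ((adjoint (transpose T) : weak_star (dual E) -> weak (dual X)) @`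
    [set M : dual (dual E) | `|M| <= 1]) => //.
apply: (@continuous_compact (weak_star (dual E)) (weak (dual X))); last first.
  exact: weak_star_ball_compact.
apply: continuous_subspaceT; apply/sigma_continuousP => N.
rewrite (_ : (fun _ => _) =
    (fun M : weak_star (dual E) => (M : dual (dual E)) (adjoint T N))).
  exact: (@sigma_eval_continuous _ _ _ (fun (N : dual (dual E)) f => N f)).
by apply/funext => M; exact: rT.
Qed.

Lemma regular_weakly_compact (E X : normedModType C) (T : blin E (dual X)) :
  arens_regular T -> weakly_compact_map T.
Proof.
move=> /regular_weakly_compact_adjoint rT.
have -> : (T : E -> dual X) = adjoint (transpose T) \o bidual E.
  by apply/funext => a; exact: blinP.
exact: weakly_compact_map_precomp.
Qed.

(** A form of Gantmacher's theorem: regularity is symmetric in the two variables. *)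
Lemma weakly_compact_transpose (E X : normedModType C) (T : blin E (dual X)) :
  weakly_compact_map T -> weakly_compact_map (transpose T).
Proof.
move=> /weakly_compact_regular/arens_regular_transpose.
exact: regular_weakly_compact.
Qed.

Lemma closed_ker (E F : normedModType C) (Q : blin E F) :
  closed [set x | Q x = 0].
Proof.
apply: (proj1 (continuous_closedP Q) (@blin_cont _ _ _ Q) [set 0]).
apply: accessible_closed_set1; apply: hausdorff_accessible.
exact: norm_hausdorff.
Qed.

End Regularity.

Lemma blin_subr_eq0 (R : realType) (E F : normedModType R[i])
  (f g : blin E F) (x : E) : (f - g) x = 0 <-> f x = g x.
Proof. by rewrite blinBE; split=> [/eqP|->]; rewrite ?subrr// subr_eq0 => /eqP. Qed.

(** * Weakly almost periodic functionals *)

Section WeaklyAlmostPeriodic.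
Context (R : realType) (A : banachAlg R).
Local Notation C := (R[i]).
Local Notation mul := (@ba_mul R A).

Section Bimodule.
Context (X : bimodule mul).
Let Xax := bm_axiom X.
Local Notation DX := (dual_bimodule X).

Definition lform (w : dual X) : blin A (dual X) := lorbit (X := DX) w.
Definition rform (w : dual X) : blin A (dual X) := rorbit (X := DX) w.

Lemma wapP (w : dual X) : wap_set (X := DX) w <->
  arens_regular (lform w) /\ arens_regular (rform w).
Proof.
split=> [[lw rw]|[lw rw]]; split.
- exact: (@weakly_compact_regular _ _ _ (lform w)).
- exact: (@weakly_compact_regular _ _ _ (rform w)).
- exact: (@regular_weakly_compact _ _ _ (lform w)).
- exact: (@regular_weakly_compact _ _ _ (rform w)).
Qed.

(* lconv M w = M.w and rconv M w = w.M, that is (M.w)(x) = M(a |-> w(x.a)) and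
   (w.M)(x) = M(a |-> w(a.x)). *)
Definition lconv (M : dual (dual A)) : blin (dual X) (dual X).
Proof.
refine (@mkblin _ (dual X) (dual X)
  (fun w => adjoint (transpose (lform w)) M) _ _).
- move=> c v w; apply: blinP => x /=; rewrite -linearP; congr (M _).
  exact: blinP.
- have [k k0 kP] := bounded_bilin_ge0 (bm_rbilin Xax).
  exists (`|M| * k) => w; apply: blin_norm_le => [|x]; first by rewrite !mulr_ge0.
  apply: le_trans (le_blin_norm M _) _; rewrite -!mulrA ler_wpM2l//.
  apply: blin_norm_le => [|a]; first by rewrite !mulr_ge0.
  apply: le_trans (le_blin_norm w (ract x a)) _.
  apply: le_trans (ler_wpM2l (normr_ge0 w) (kP x a)) _.
  by rewrite le_eqVlt; apply/orP; left; apply/eqP; ring.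
Defined.

Definition rconv (M : dual (dual A)) : blin (dual X) (dual X).
Proof.
refine (@mkblin _ (dual X) (dual X)
  (fun w => adjoint (transpose (rform w)) M) _ _).
- move=> c v w; apply: blinP => x /=; rewrite -linearP; congr (M _).
  exact: blinP.
- have [k k0 kP] := bounded_bilin_ge0 (bm_lbilin Xax).
  exists (`|M| * k) => w; apply: blin_norm_le => [|x]; first by rewrite !mulr_ge0.
  apply: le_trans (le_blin_norm M _) _; rewrite -!mulrA ler_wpM2l//.
  apply: blin_norm_le => [|a]; first by rewrite !mulr_ge0.
  apply: le_trans (le_blin_norm w (lact a x)) _.
  apply: le_trans (ler_wpM2l (normr_ge0 w) (kP a x)) _.
  by rewrite le_eqVlt; apply/orP; left; apply/eqP; ring.
Defined.

(** By [wapP], membership means that for all [M] and [N] two bounded functionals of [w] agree, so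
    the set is an intersection of kernels. *)
Lemma wap_closed : closed (wap_set (X := DX)).
Proof.
have -> : wap_set (X := DX) = \bigcap_(p in [set: dual (dual A) * dual (dual X)])
  ([set w | (blin_comp p.2 (lconv p.1) -
      blin_comp p.1 (transpose (rorbit (X := dual_bimodule DX) p.2))) w = 0] `&`
   [set w | (blin_comp p.2 (rconv p.1) -
      blin_comp p.1 (transpose (lorbit (X := dual_bimodule DX) p.2))) w = 0]).
  apply/seteqP; split=> w.
    move=> /wapP[lw rw] [M N] _; split; apply/blin_subr_eq0; rewrite /=.
      rewrite (lw M N); congr (M _); exact: blinP.
    rewrite (rw M N); congr (M _); exact: blinP.
  move=> H; apply/wapP; split=> M N;
    have [/blin_subr_eq0 e /blin_subr_eq0 f] := H (M, N) I.
    apply: (etrans e); rewrite /=; congr (M _); exact: blinP.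
  apply: (etrans f); rewrite /=; congr (M _); exact: blinP.
by apply: closed_bigI => p _; apply: closedI; exact: closed_ker.
Qed.

(** Elements of F(A) will be applied to these coefficients a |-> w(x.a). Their orbit maps factor
    through [lform w] or its transpose, both weakly compact. *)
Lemma wap_coef_l (w : dual X) (x : X) : wap_set (X := DX) w ->
  wap_set (X := dual_bimodule (regular A)) (transpose (lform w) x).
Proof.
move=> [lw _]; split.
  have -> : (fun a : A => lact a (transpose (lform w) x : dual_bimodule (regular A))) =
      adjoint (rorbit x) \o lform w.
    by apply/funext => a; apply: blinP => b /=; rewrite (bm_rA Xax).
  exact: weakly_compact_map_comp.
have -> : (fun a : A => ract (transpose (lform w) x : dual_bimodule (regular A)) a) =
    transpose (lform w) \o rorbit x.
  by apply/funext => a; apply: blinP => b /=; rewrite (bm_rA Xax).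
by apply: weakly_compact_map_precomp; exact: weakly_compact_transpose.
Qed.

Lemma wap_coef_r (w : dual X) (x : X) : wap_set (X := DX) w ->
  wap_set (X := dual_bimodule (regular A)) (transpose (rform w) x).
Proof.
move=> [_ rw]; split.
  have -> : (fun a : A => lact a (transpose (rform w) x : dual_bimodule (regular A))) =
      transpose (rform w) \o lorbit x.
    by apply/funext => a; apply: blinP => b /=; rewrite (bm_lA Xax).
  by apply: weakly_compact_map_precomp; exact: weakly_compact_transpose.
have -> : (fun a : A => ract (transpose (rform w) x : dual_bimodule (regular A)) a) =
    adjoint (lorbit x) \o rform w.
  by apply/funext => a; apply: blinP => b /=; rewrite (bm_lA Xax).
exact: weakly_compact_map_comp.
Qed.

(** Since a.(M.w) = (a.M).w, the left orbit factors through [adjoint (transpose (lform w))], which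
    is weakly compact on the whole bidual; the right orbit is [lconv M] after [rform w]. *)
Lemma wap_lconv (M : dual (dual A)) (w : dual X) :
  wap_set (X := DX) w -> wap_set (X := DX) (lconv M w).
Proof.
move=> ww; have [lw rw] := ww; split.
  have -> : (fun a : A => lact a (lconv M w : DX)) =
      adjoint (transpose (lform w)) \o
        lorbit (X := dual_bimodule (dual_bimodule (regular A))) M.
    apply/funext => a; apply: blinP => x /=; congr (M _).
    by apply: blinP => b /=; rewrite (bm_rA Xax).
  apply: weakly_compact_map_precomp; apply: regular_weakly_compact_adjoint.
  exact: weakly_compact_regular.
have -> : (fun a : A => ract (lconv M w : DX) a) = lconv M \o rform w.
  apply/funext => a; apply: blinP => x /=; congr (M _).
  by apply: blinP => b /=; rewrite (bm_lrA Xax).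
exact: weakly_compact_map_comp.
Qed.

Lemma wap_rconv (M : dual (dual A)) (w : dual X) :
  wap_set (X := DX) w -> wap_set (X := DX) (rconv M w).
Proof.
move=> ww; have [lw rw] := ww; split; last first.
  have -> : (fun a : A => ract (rconv M w : DX) a) =
      adjoint (transpose (rform w)) \o
        rorbit (X := dual_bimodule (dual_bimodule (regular A))) M.
    apply/funext => a; apply: blinP => x /=; congr (M _).
    by apply: blinP => b /=; rewrite (bm_lA Xax).
  apply: weakly_compact_map_precomp; apply: regular_weakly_compact_adjoint.
  exact: weakly_compact_regular.
have -> : (fun a : A => lact a (rconv M w : DX)) = rconv M \o lform w.
  apply/funext => a; apply: blinP => x /=; congr (M _).
  by apply: blinP => b /=; rewrite (bm_lrA Xax).
exact: weakly_compact_map_comp.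
Qed.

End Bimodule.
End WeaklyAlmostPeriodic.

(** * The action of F(A) on W(X) and the product of F(A) *)

Section EnvelopingAction.
Context (R : realType) (A : banachAlg R).
Local Notation C := (R[i]).
Local Notation mul := (@ba_mul R A).
Local Notation F := (dual (FA_pre (regular A))).

Lemma wap_lift (X : bimodule mul) (phi : FA X) :
  exists M : dual (dual X), forall w : wap (dual_bimodule X), M (val w) = phi w.
Proof. exact: (@bidual_lift _ X _ (subspace_incl (wap (dual_bimodule X))) phi). Qed.

(** [FA_lift b] is an arbitrary element of the fibre over [b], nonempty by [wap_lift]; on weakly
    almost periodic functionals the choice does not show. *)
Lemma FA_liftE (b : F) (f : wap (dual_bimodule (regular A))) :
  FA_lift b (val f) = b f.
Proof.
suff H : FA_quot (regular A) (FA_lift b) = b by rewrite -[in RHS]H.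
rewrite /FA_lift; apply: (@getPex _ [set M | FA_quot (regular A) M = b]).
have [M Mb] := @wap_lift (regular A) b; exists M; exact: blinP.
Qed.

Section Action.
Context (X : bimodule mul).
Let Xax := bm_axiom X.
Local Notation W := (wap (dual_bimodule X)).

Definition coefl (w : W) (x : X) : wap (dual_bimodule (regular A)) :=
  exist _ (transpose (lform (val w)) x)
    (mem_set (wap_coef_l x (subspace_valP w))).
Definition coefr (w : W) (x : X) : wap (dual_bimodule (regular A)) :=
  exist _ (transpose (rform (val w)) x)
    (mem_set (wap_coef_r x (subspace_valP w))).

Definition env_lact (b : F) (w : W) : W :=
  blin_restrict (V := W) (W := W) (@wap_lconv R A X (FA_lift b)) w.
Definition env_ract (w : W) (b : F) : W :=
  blin_restrict (V := W) (W := W) (@wap_rconv R A X (FA_lift b)) w.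

(** The coefficient is weakly almost periodic, so the action depends on [b] and not on its
    representative in the bidual. *)
Lemma env_lactE b w x : val (env_lact b w) x = b (coefl w x).
Proof. by rewrite -FA_liftE. Qed.
Lemma env_ractE w b x : val (env_ract w b) x = b (coefr w x).
Proof. by rewrite -FA_liftE. Qed.

Lemma wap_inj (v w : W) : (forall x, val v x = val w x) -> v = w.
Proof. by move=> vw; apply: val_inj; exact: blinP. Qed.

Lemma wap_linE (v w : W) (c : C) x :
  val (c *: v + w) x = c *: val v x + val w x.
Proof. by rewrite linearP. Qed.

Lemma env_lact_eta (a : A) w : env_lact (FA_eta (regular A) a) w = wap_l a w.
Proof. by apply: wap_inj => x; rewrite env_lactE. Qed.
Lemma env_ract_eta w (a : A) : env_ract w (FA_eta (regular A) a) = wap_r w a.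
Proof. by apply: wap_inj => x; rewrite env_ractE. Qed.

Lemma env_lact_bilin : bounded_bilin env_lact.
Proof.
have [k k0 kP] := bounded_bilin_ge0 (bm_rbilin Xax).
split; first split.
- by move=> w c a b; apply: wap_inj => x; rewrite wap_linE !env_lactE.
- by move=> b c v w; rewrite /env_lact linearP.
- exists k => b w; apply: blin_norm_le => [|x]; first by rewrite !mulr_ge0.
  rewrite env_lactE; apply: le_trans (le_blin_norm b _) _.
  rewrite (mulrC k) -!mulrA ler_wpM2l//.
  apply: blin_norm_le => [|a]; first by rewrite !mulr_ge0.
  apply: le_trans (le_blin_norm (val w) (ract x a)) _.
  apply: le_trans (ler_wpM2l (normr_ge0 _) (kP x a)) _.
  by rewrite le_eqVlt; apply/orP; left; apply/eqP; ring.
Qed.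

Lemma env_ract_bilin : bounded_bilin env_ract.
Proof.
have [k k0 kP] := bounded_bilin_ge0 (bm_lbilin Xax).
split; first split.
- by move=> b c v w; rewrite /env_ract linearP.
- by move=> w c a b; apply: wap_inj => x; rewrite wap_linE !env_ractE.
- exists k => w b; apply: blin_norm_le => [|x]; first by rewrite !mulr_ge0.
  rewrite env_ractE; apply: le_trans (le_blin_norm b _) _.
  rewrite (mulrAC k) (mulrC k) -!mulrA ler_wpM2l//.
  apply: blin_norm_le => [|a]; first by rewrite !mulr_ge0.
  apply: le_trans (le_blin_norm (val w) (lact a x)) _.
  apply: le_trans (ler_wpM2l (normr_ge0 _) (kP a x)) _.
  by rewrite le_eqVlt; apply/orP; left; apply/eqP; ring.
Qed.

(** Both sides apply [b] and [c] to the values w(a'.x.a), in opposite orders. Regularity of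
    [lform w], tested on the functional [N], exchanges them. *)
Lemma env_lractA b w c : env_ract (env_lact b w) c = env_lact b (env_ract w c).
Proof.
apply: wap_inj => x; have [lw _] := (wapP _).1 (subspace_valP w).
pose N : dual (dual X) := blin_comp (FA_lift c) (adjoint (lorbit x)).
transitivity (N (lconv X (FA_lift b) (val w))).
  by rewrite /=; congr (FA_lift c _); exact: blinP.
rewrite (lw (FA_lift b) N) /=; congr (FA_lift b _).
apply: blinP => a /=; congr (FA_lift c _).
by apply: blinP => a' /=; rewrite (bm_lrA Xax).
Qed.

End Action.

Lemma FAalg_mulE (b c : F) (f : wap (dual_bimodule (regular A))) :
  (FAalg_mul b c : F) f = b (env_lact (X := regular A) c f).
Proof.
rewrite -[RHS]FA_liftE /=; congr (FA_lift b _); apply: blinP => a /=.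
by congr (FA_lift c _); exact: blinP.
Qed.

(** The same exchange for the regular bimodule: the two Arens products agree on weakly almost
    periodic functionals. *)
Lemma FAalg_mulE_r (b c : F) (f : wap (dual_bimodule (regular A))) :
  (FAalg_mul b c : F) f = c (env_ract (X := regular A) f b).
Proof.
have [lf _] := (wapP _).1 (subspace_valP f).
rewrite FAalg_mulE -[LHS]FA_liftE -[RHS]FA_liftE /= (lf (FA_lift c) (FA_lift b)).
by congr (FA_lift c _); apply: blinP => a /=; congr (FA_lift b _); exact: blinP.
Qed.

Section Action2.
Context (X : bimodule mul).
Let Xax := bm_axiom X.

Lemma env_lactA b c (w : wap (dual_bimodule X)) :
  env_lact (FAalg_mul b c) w = env_lact b (env_lact c w).
Proof.
apply: wap_inj => x; rewrite !env_lactE FAalg_mulE; congr (b _).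
apply: wap_inj => a; rewrite env_lactE [RHS]env_lactE; congr (c _).
by apply: wap_inj => a' /=; rewrite (bm_rA Xax).
Qed.

Lemma env_ractA (w : wap (dual_bimodule X)) b c :
  env_ract w (FAalg_mul b c) = env_ract (env_ract w b) c.
Proof.
apply: wap_inj => x; rewrite !env_ractE FAalg_mulE_r; congr (c _).
apply: wap_inj => a; rewrite env_ractE [RHS]env_ractE; congr (b _).
by apply: wap_inj => a' /=; rewrite (bm_lA Xax).
Qed.

Lemma env_is_bimodule : is_bimodule (@FAalg_mul R A) (@env_lact X) (@env_ract X).
Proof.
split; [exact: env_lact_bilin|exact: env_ract_bilin|exact: env_lactA|exact: env_ractA|].
by move=> *; exact: env_lractA.
Qed.

Definition env_bimodule : bimodule (@FAalg_mul R A) := Bimodule env_is_bimodule.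

End Action2.

Lemma FAalg_is_banach_algebra : is_banach_algebra (@FAalg_mul R A).
Proof.
split.
- move=> a b c; apply: blinP => f.
  by rewrite !FAalg_mulE; congr (a _); rewrite env_lactA.
- split=> [c|b] k x y; apply: blinP => f.
    by rewrite blinDE blinZE !FAalg_mulE.
  by rewrite blinDE blinZE !FAalg_mulE_r.
- move=> b c; apply: blin_norm_le => [|f]; first by rewrite mulr_ge0.
  rewrite FAalg_mulE; apply: le_trans (le_blin_norm b _) _.
  rewrite -mulrA ler_wpM2l//.
  apply: blin_norm_le => [|x]; first by rewrite mulr_ge0.
  rewrite env_lactE; apply: le_trans (le_blin_norm c _) _.
  rewrite -mulrA ler_wpM2l//.
  apply: blin_norm_le => [|a]; first by rewrite mulr_ge0.
  apply: le_trans (le_blin_norm (val f) _) _.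
  by rewrite -mulrA ler_wpM2l//; exact: (ba_norm (ba_axiom A)).
Qed.

Lemma FA_eta_mul (a b : A) :
  FAalg_mul (FA_eta (regular A) a) (FA_eta (regular A) b) =
  FA_eta (regular A) (mul a b).
Proof. by apply: blinP => f; rewrite FAalg_mulE env_lact_eta. Qed.

End EnvelopingAction.

(** * Closed subspaces as Banach spaces *)

Section SubspaceComplete.
Context (R : realType).
Local Notation C := (R[i]).

Definition mksub (E : normedModType C) (V : Defs.subspace E) (x : E)
  (Vx : subspace_set V x) : V := exist _ x (mem_set Vx).

Definition corestrict (E F : normedModType C) (T : blin E F)
    (V : Defs.subspace F) (TV : forall x, subspace_set V (T x)) : blin E V.
Proof.
refine (@mkblin _ E V (fun x => mksub (TV x)) _ _).
- by move=> c x y; apply: val_inj; rewrite [RHS]linearP; exact: (linearP T).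
- by exists `|T| => x; exact: le_blin_norm.
Defined.

Lemma closed_subspace_complete (E : completeNormedModType C) (V : Defs.subspace E) :
  closed (subspace_set V) ->
  forall F : set_system V, ProperFilter F -> cauchy F -> cvg F.
Proof.
move=> Vcl F FF /cauchy_ballP Fc.
have /cauchy_cvgP/cvg_ex[l Fl] : cauchy (val @ F : set_system E).
  apply/cauchy_ballP => e e0; have [[P Q] /= [FP FQ] PQ] := Fc e e0.
  exists (val @` P, val @` Q).
    by split => /=; [apply: filterS FP|apply: filterS FQ] => x Hx; exists x.
  move=> [_ _] [/= [x Px <-] [y Qy <-]].
  have := PQ (x, y) (conj Px Qy); rewrite /= -!ball_normE /=.
  by have -> : val x - val y = val (x - y) by rewrite raddfB.
have Vl : subspace_set V l.
  apply: (closed_cvg _ Vcl _ _ Fl).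
  by apply: nearW => x; exact: subspace_valP.
pose l' : V := mksub Vl.
apply/cvg_ex; exists l'; apply/cvgrPdist_lt => e e0.
move/cvgrPdist_lt : Fl => /(_ _ e0); apply: filterS => x.
by have -> : l - val x = val (l' - x) by rewrite raddfB.
Qed.

(** Connes-amenability quantifies over complete spaces, whereas a subspace comes with a normed
    structure only; the complete structure is put on the same type. *)
Definition closed_subspace (E : completeNormedModType C) (V : Defs.subspace E)
    (Vcl : closed (subspace_set V)) : completeNormedModType C :=
  HB.pack (subspace_type V)
    (Uniform_isComplete.Build (subspace_type V) (closed_subspace_complete Vcl)).

Section ClosedSubspace.
Context (E : completeNormedModType C) (V : Defs.subspace E).
Context (Vcl : closed (subspace_set V)).

Definition closed_subspace_val : blin (closed_subspace Vcl) V.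
Proof.
refine (@mkblin _ (closed_subspace Vcl) V id _ _) => //.
by exists 1 => x; rewrite mul1r.
Defined.

Definition closed_subspace_mk : blin V (closed_subspace Vcl).
Proof.
refine (@mkblin _ V (closed_subspace Vcl) id _ _) => //.
by exists 1 => x; rewrite mul1r.
Defined.

Lemma closed_subspace_valK : cancel closed_subspace_val closed_subspace_mk.
Proof. by []. Qed.

Lemma closed_subspace_mkK : cancel closed_subspace_mk closed_subspace_val.
Proof. by []. Qed.

End ClosedSubspace.

End SubspaceComplete.

(** * The predual of F(A), weak* density of A, and normality of F_A(X) *)

Section EnvelopingDual.
Context (R : realType) (A : banachAlg R).
Local Notation C := (R[i]).
Local Notation mul := (@ba_mul R A).
Local Notation WA := (FA_pre (regular A)).
Local Notation F := (dual WA).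
Local Notation P := (FAalg_predual A).

(* Exhibits the predual as an intersection of preimages of closed sets: an
   element p is evaluation at the only possible candidate, p o eta. *)
Lemma predualE : subspace_set P =
  [set p | wap_set (X := dual_bimodule (regular A)) (adjoint (FA_eta (regular A)) p)] `&`
  \bigcap_(b in [set: F]) [set p : dual F |
    (blin_comp (FA_lift b) (adjoint (FA_eta (regular A))) - bidual F b) p = 0].
Proof.
apply/seteqP; split=> [_ [w _ <-]|p [wp H]].
  have e : adjoint (FA_eta (regular A)) (bidual WA w) = val w by exact: blinP.
  split=> [|b _].
    by rewrite /mkset e; exact: (@subspace_valP _ _ (wap (dual_bimodule (regular A))) w).
  by apply/blin_subr_eq0; rewrite -[RHS](FA_liftE b w) -e.
exists (mksub (V := wap (dual_bimodule (regular A))) wp) => //; apply: blinP => b.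
have /blin_subr_eq0 e := H b I.
by apply: etrans e; exact: esym (FA_liftE b _).
Qed.

Lemma predual_closed : closed (subspace_set P).
Proof.
rewrite predualE; apply: closedI.
  apply: (proj1 (continuous_closedP (adjoint (FA_eta (regular A)))) _ _ (@wap_closed _ _ _)).
  exact: blin_cont.
by apply: closed_bigI => b _; exact: closed_ker.
Qed.

Definition predual_incl : blin WA P :=
  @corestrict _ _ _ (bidual WA) P (fun w => ex_intro2 _ _ w I erefl).

Lemma FA_is_dual_banach_algebra : is_dual_banach_algebra (@FAalg_mul R A) P.
Proof.
split.
- exact: FAalg_is_banach_algebra.
- exact: predual_closed.
- move=> b f; have [w _ fw] := subspace_valP f.
  exists (predual_incl (env_lact b w)) => c.
  rewrite -fw; exact: esym (FAalg_mulE c b w).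
- move=> f b; have [w _ fw] := subspace_valP f.
  exists (predual_incl (env_ract w b)) => c.
  rewrite -fw; exact: esym (FAalg_mulE_r b c w).
- exists (adjoint predual_incl) => [b|p]; apply: blinP => f //=.
  have [w _ fw] := subspace_valP f.
  have -> : f = predual_incl w by apply: val_inj; rewrite -fw.
  by [].
Qed.

(** Weak* continuity is tested coefficientwise, and coefficients in the predual are among the
    functionals that define the topology. *)
Lemma predual_continuous (E : normedModType C) (S : blin F (dual E)) :
  (forall e, subspace_set P (transpose S e)) ->
  continuous (S : predual_topology P -> weak_star E).
Proof.
move=> SP; apply/sigma_continuousP => e; have [w _ we] := SP e.
have -> : (fun b => S b e) = (fun b => val (predual_incl w) b).
  by apply/funext => b; have /= -> := congr1 (fun p : dual F => p b) we.
exact: (@sigma_eval_continuous _ _ _ (fun (b : FAalg A) (f : P) => val f b)).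
Qed.

Lemma predual_ball_compact :
  compact ([set b : FAalg A | `|b| <= 1] : set (predual_topology P)).
Proof.
have -> : [set b : FAalg A | `|b| <= 1] =
    (id : weak_star WA -> predual_topology P) @` [set b : F | `|b| <= 1].
  by rewrite image_id.
apply: (@continuous_compact (weak_star WA) (predual_topology P)); last first.
  exact: weak_star_ball_compact.
apply: continuous_subspaceT; apply/sigma_continuousP => f.
have [w _ fw] := subspace_valP f.
have -> : (fun b : weak_star WA => val f b) = (fun b => (b : F) w).
  by apply/funext => b; rewrite -fw.
exact: (@sigma_eval_continuous _ _ _ (fun (b : F) w => b w)).
Qed.

(** Goldstine's theorem for the inclusion of W(A) in the dual of A makes [b] a weak* limit of points
    of eta(A). Weak*-continuous identities thus need checking on A only. *)
Lemma eta_dense (g h : FAalg A -> C) :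
  continuous (g : predual_topology P -> C) ->
  continuous (h : predual_topology P -> C) ->
  (forall a, g (FA_eta (regular A) a) = h (FA_eta (regular A) a)) -> g = h.
Proof.
move=> gc hc gh; apply/funext => b.
have r0 : 0 < `|b| + 1 by rewrite ltr_wpDl.
have [||U [UU _ Ub]] := @goldstine_ultra _ A WA
    (subspace_incl (wap (dual_bimodule (regular A)))) b (`|b| + 1) => // [f|].
  by rewrite (le_trans (le_blin_norm (b : F) f))// ler_pM// lerDl.
have Uc : FA_eta (regular A) @ U --> (b : predual_topology P).
  apply: sigma_cvg => f; have [w _ fw] := subspace_valP f.
  by rewrite -fw; exact: Ub.
have Ug := cvg_comp _ _ Uc (gc b); have Uh := cvg_comp _ _ Uc (hc b).
apply: (cvg_unique _ Ug); first exact: norm_hausdorff.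
have -> : g \o FA_eta (regular A) = h \o FA_eta (regular A).
  exact/funext.
exact: Uh.
Qed.

Section Normal.
Context (X : bimodule mul).
Local Notation DX := (dual_bimodule X).
Local Notation DDX := (dual_bimodule DX).
Let Xax := bm_axiom X.

(** For [N] lifting [phi], the functional a |-> N(a.w) will represent the coefficient c |-> phi(c.w)
    in the predual. *)
Lemma wap_orbit_l (w : wap DX) (N : dual (dual X)) :
  wap_set (X := dual_bimodule (regular A)) (adjoint (lform (val w)) N).
Proof.
have [lw rw] := subspace_valP w; split.
  have -> : (fun a : A => lact a (adjoint (lform (val w)) N : dual_bimodule (regular A))) =
      transpose (rorbit (X := DDX) N) \o lform (val w).
    apply/funext => b; apply: blinP => a /=; congr (N _).
    by apply: blinP => x /=; rewrite (bm_rA Xax).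
  exact: weakly_compact_map_comp.
have -> : (fun a : A => ract (adjoint (lform (val w)) N : dual_bimodule (regular A)) a) =
    adjoint (lform (val w)) \o rorbit (X := DDX) N.
  apply/funext => b; apply: blinP => a /=; congr (N _).
  by apply: blinP => x /=; rewrite (bm_rA Xax).
(* Writing [lform] as a double transpose makes its adjoint an instance of
   [regular_weakly_compact_adjoint]. *)
apply: weakly_compact_map_precomp; rewrite -[lform _]transposeK.
apply: regular_weakly_compact_adjoint; apply: arens_regular_transpose.
exact: weakly_compact_regular.
Qed.

Lemma wap_orbit_r (w : wap DX) (N : dual (dual X)) :
  wap_set (X := dual_bimodule (regular A)) (adjoint (rform (val w)) N).
Proof.
have [lw rw] := subspace_valP w; split; last first.
  have -> : (fun a : A => ract (adjoint (rform (val w)) N : dual_bimodule (regular A)) a) =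
      transpose (lorbit (X := DDX) N) \o rform (val w).
    apply/funext => b; apply: blinP => a /=; congr (N _).
    by apply: blinP => x /=; rewrite (bm_lA Xax).
  exact: weakly_compact_map_comp.
have -> : (fun a : A => lact a (adjoint (rform (val w)) N : dual_bimodule (regular A))) =
    adjoint (rform (val w)) \o lorbit (X := DDX) N.
  apply/funext => b; apply: blinP => a /=; congr (N _).
  by apply: blinP => x /=; rewrite (bm_lA Xax).
apply: weakly_compact_map_precomp; rewrite -[rform _]transposeK.
apply: regular_weakly_compact_adjoint; apply: arens_regular_transpose.
exact: weakly_compact_regular.
Qed.

(** This is half of the normality of F_A(X): regularity of [lform w] gives N(c.w) = c(a |->
    N(a.w)). *)
Lemma predual_orbit_l (phi : FA X) (w : wap DX) :
  subspace_set P (transpose (rorbit (X := dual_bimodule (env_bimodule X)) phi) w).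
Proof.
have [N Nphi] := wap_lift phi.
have [lw _] := (wapP _).1 (subspace_valP w).
exists (mksub (V := wap (dual_bimodule (regular A))) (wap_orbit_l w N)) => //.
apply: blinP => c.
by rewrite -[LHS]FA_liftE -[RHS]Nphi /= (lw (FA_lift c) N).
Qed.

Lemma predual_orbit_r (phi : FA X) (w : wap DX) :
  subspace_set P (transpose (lorbit (X := dual_bimodule (env_bimodule X)) phi) w).
Proof.
have [N Nphi] := wap_lift phi.
have [_ rw] := (wapP _).1 (subspace_valP w).
exists (mksub (V := wap (dual_bimodule (regular A))) (wap_orbit_r w N)) => //.
apply: blinP => c.
by rewrite -[LHS]FA_liftE -[RHS]Nphi /= (rw (FA_lift c) N).
Qed.

End Normal.
End EnvelopingDual.

(** * Derivations on an algebra with a unit that need not act as the identity *)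

Section Inner.
Context (R : realType) (B : completeNormedModType R[i]) (mul : B -> B -> B).
Context (X : bimodule mul) (D : B -> X) (e : B) (x : X).
Let Xax := bm_axiom X.

(** The rule D b = e.D b + (D e).b splits [D] into the part given by [x] and a part given by
    [z = D e]. *)
Lemma inner_of_unit_corner :
  (forall b, mul e b = b) -> (forall b, mul b e = b) -> derivation D ->
  (forall b, lact e (D b) = lact b x - ract x b) -> inner D.
Proof.
move=> eb be Dd H.
have lB a u v : lact a (u - v : X) = lact a u - lact a v.
  exact: (linearB (lact_blin X a)).
have lD a u v : lact a (u + v : X) = lact a u + lact a v.
  exact: (linearD (lact_blin X a)).
have rB a u v : ract (u - v : X) a = ract u a - ract v a.
  exact: (linearB (ract_blin X a)).
have rD a u v : ract (u + v : X) a = ract u a + ract v a.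
  exact: (linearD (ract_blin X a)).
pose z := D e.
(* Applying [e] to D e = e.D e + (D e).e cancels e.D e. *)
have eze : ract (lact e z) e = 0.
  have := congr1 (lact e) (Dd e e); rewrite eb lD -(bm_lA Xax) eb -/z => /esym/eqP.
  by rewrite -subr_eq0 addrAC subrr add0r (bm_lrA Xax) => /eqP.
have ezb b : ract (lact e z) b = 0.
  by rewrite -[in LHS](eb b) (bm_rA Xax) eze; exact: (linear0 (ract_blin X b)).
(* The term e.x yields e.D b, [- z] yields z.b, and e.z cancels the unwanted b.z without a right
   term, by [ezb]. *)
exists (lact e x - z + lact e z) => b.
rewrite lD lB rD rB -!(bm_lA Xax) be ezb addr0 subrK (bm_lrA Xax).
have eDb : lact e (D b) = lact b x - lact e (ract x b).
  by rewrite -[in LHS](eb e) (bm_lA Xax) H lB -(bm_lA Xax) eb.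
rewrite opprB -[in LHS](eb b) Dd eDb -/z -addrA.
by congr (_ + _); exact: addrC.
Qed.

End Inner.

(** * From a virtual diagonal to Connes-amenability *)

Section VirtualDiagonalToConnes.
Context (R : realType) (A : banachAlg R) (T : projTensor A A).
Local Notation C := (R[i]).
Local Notation mul := (@ba_mul R A).
Local Notation RA := (regular A).
Local Notation F := (dual (FA_pre RA)).
Local Notation P := (FAalg_predual A).
Local Notation eta := (FA_eta RA).
Local Notation WA := (wap (dual_bimodule RA)).

(** The canonical embedding of [E] in its bidual reduces this to a transpose. *)
Lemma weakly_compact_adjoint (E : normedModType C) (Z : normedModType C)
    (S : blin Z E) : weakly_compact_map S -> weakly_compact_map (adjoint S).
Proof.
move=> Sc; have -> : adjoint S = transpose (blin_comp (bidual E) S).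
  by apply: blinP => f; exact: blinP.
apply: weakly_compact_transpose; exact: (@weakly_compact_map_comp _ _ _ _ (bidual E) S Sc).
Qed.

Context (E : completeNormedModType C) (l : F -> E -> E) (r : E -> F -> E).
Context (El : is_bimodule (@FAalg_mul R A) l r).
Local Notation X := (Bimodule El).
Local Notation M := (dual_bimodule X).
Hypothesis Enorm : normal_dual P X.

Lemma normal_continuous_r (phi : dual E) (y : E) :
  continuous ((fun b => phi (r y b)) : predual_topology P -> C).
Proof. exact: ((sigma_continuousP _).1 (Enorm phi).1 y). Qed.
Lemma normal_continuous_l (phi : dual E) (y : E) :
  continuous ((fun b => phi (l b y)) : predual_topology P -> C).
Proof. exact: ((sigma_continuousP _).1 (Enorm phi).2 y). Qed.

Definition eta_r (y : E) : blin A E := blin_comp (rorbit (X := X) y) eta.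
Definition eta_l (y : E) : blin A E := blin_comp (lorbit (X := X) y) eta.

(** By normality the orbit map of [y] is weak*-to-weak continuous on F(A), whose unit ball is weak*
    compact. *)
Lemma eta_r_compact (y : E) : weakly_compact_map (eta_r y).
Proof.
apply: (@weakly_compact_map_precomp _ _ _ _ eta (rorbit (X := X) y)).
apply/precompact_sub_compact.
exists ((rorbit (X := X) y : predual_topology P -> weak E) @` [set b | `|b| <= 1]) => //.
apply: (@continuous_compact (predual_topology P) (weak E)); last first.
  exact: predual_ball_compact.
apply: continuous_subspaceT; apply/sigma_continuousP => phi.
exact: normal_continuous_r.
Qed.

Lemma eta_l_compact (y : E) : weakly_compact_map (eta_l y).
Proof.
apply: (@weakly_compact_map_precomp _ _ _ _ eta (lorbit (X := X) y)).
apply/precompact_sub_compact.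
exists ((lorbit (X := X) y : predual_topology P -> weak E) @` [set b | `|b| <= 1]) => //.
apply: (@continuous_compact (predual_topology P) (weak E)); last first.
  exact: predual_ball_compact.
apply: continuous_subspaceT; apply/sigma_continuousP => phi.
exact: normal_continuous_l.
Qed.

Lemma r_eta_mul y a b : r y (eta (mul a b)) = r (r y (eta a)) (eta b).
Proof. by rewrite -FA_eta_mul; exact: (bm_rA El). Qed.

(** Both orbit maps of a |-> phi(y.a) factor through the weakly compact [eta_r y] or its adjoint. *)
Lemma wap_normal_coef (phi : dual E) (y : E) :
  wap_set (X := dual_bimodule RA) (adjoint (eta_r y) phi).
Proof.
split.
  have -> : (fun a : A => lact a (adjoint (eta_r y) phi : dual_bimodule RA)) =
      adjoint (eta_r y) \o blin_comp (lorbit (X := M) phi) eta.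
    by apply/funext => b; apply: blinP => a /=; rewrite r_eta_mul.
  apply: weakly_compact_map_precomp; apply: weakly_compact_adjoint.
  exact: eta_r_compact.
have -> : (fun a : A => ract (adjoint (eta_r y) phi : dual_bimodule RA) a) =
    transpose (blin_comp (lorbit (X := M) phi) eta) \o eta_r y.
  by apply/funext => b; apply: blinP => a /=; rewrite r_eta_mul.
apply: weakly_compact_map_comp; exact: eta_r_compact.
Qed.

Definition normal_coef (phi : dual E) (y : E) : WA :=
  @mksub R _ WA (adjoint (eta_r y) phi) (wap_normal_coef phi y).

Lemma normal_coefE (phi : dual E) (y : E) (b : F) :
  b (normal_coef phi y) = phi (r y b).
Proof.
have H : (fun b : F => b (normal_coef phi y)) = (fun b => phi (r y b)).
  apply: (@eta_dense R A) => [||a] //; last exact: normal_continuous_r.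
  exact: (@sigma_eval_continuous _ _ _ (fun (b : FAalg A) (f : P) => val f b)
    (predual_incl A (normal_coef phi y))).
exact: (congr1 (fun g : F -> C => g b) H).
Qed.

Context (D : blin (FAalg A) M).
Hypothesis Dd : derivation D.
Hypothesis Dc : continuous (D : predual_topology P -> weak_star E).

Lemma derivation_bilin : bounded_bilin
  (fun a b : A => lact (b := M) (eta a) (D (eta b)) : dual E).
Proof.
have [k k0 kP] := bounded_bilin_ge0 (bm_lbilin (bm_axiom M)).
split; first split.
- move=> b c u v; exact: (linearP (blin_comp (lorbit (X := M) (D (eta b))) eta)).
- move=> a c u v; exact: (linearP (blin_comp (lact_blin M (eta a)) (blin_comp D eta))).
- exists (k * `|eta| * (`|D| * `|eta|)) => a b.
  have ha := le_blin_norm eta a.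
  have hb := le_trans (le_blin_norm D (eta b))
    (ler_wpM2l (normr_ge0 D) (le_blin_norm eta b)).
  apply: le_trans (kP _ _) _.
  apply: le_trans (ler_pM _ _ (ler_wpM2l k0 ha) hb) _ => //.
    by rewrite mulr_ge0.
  by rewrite le_eqVlt; apply/orP; left; apply/eqP; ring.
Qed.

Definition derivation_form : blin E (dual T) :=
  transpose (pt_lift T derivation_bilin : blin T (dual E)).

Lemma derivation_formE y a b :
  derivation_form y (pt_tens T a b) = D (eta b) (r y (eta a)).
Proof. by rewrite /= pt_liftE. Qed.

(* <D(bc), y.a> = <D c, y.(ab)> + <D b, (c.y).a>. *)
Lemma derivation_form_lact y c :
  lact (b := dual_bimodule (tensor_bimodule T)) c (derivation_form y) =
  derivation_form (l (eta c) y) +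
    adjoint (Delta T) (adjoint (eta_r y) (D (eta c))).
Proof.
apply: pt_ext => a b.
have -> : lact (b := dual_bimodule (tensor_bimodule T)) c (derivation_form y)
    (pt_tens T a b) = derivation_form y (pt_tens T a (mul b c)).
  by congr (derivation_form y _); exact: tensor_ractE.
rewrite blinDE !derivation_formE -FA_eta_mul Dd [LHS]blinDE [RHS]addrC.
congr (_ + _).
  transitivity (D (eta c) (r y (eta (mul a b)))); first by rewrite r_eta_mul.
  by have <- : Delta T (pt_tens T a b) = mul a b by exact: pt_liftE.
by congr (D (eta b) _); exact: (esym (bm_lrA El _ _ _)).
Qed.

Lemma derivation_form_ract y c :
  ract (b := dual_bimodule (tensor_bimodule T)) (derivation_form y) c =
  derivation_form (r y (eta c)).
Proof.
apply: pt_ext => a b.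
have -> : ract (b := dual_bimodule (tensor_bimodule T)) (derivation_form y) c
    (pt_tens T a b) = derivation_form y (pt_tens T (mul c a) b).
  by congr (derivation_form y _); exact: tensor_lactE.
by rewrite !derivation_formE r_eta_mul.
Qed.

(** The right orbit factors through [eta_r y]. On the left the derivation rule gives one term
    through [eta_l y] and one through the adjoint of [eta_r y]; all are weakly compact. *)
Lemma wap_derivation_form y :
  wap_set (X := dual_bimodule (tensor_bimodule T)) (derivation_form y).
Proof.
split; last first.
  have -> : (fun a : A => ract (b := dual_bimodule (tensor_bimodule T))
      (derivation_form y) a) = derivation_form \o eta_r y.
    by apply/funext => a; exact: derivation_form_ract.
  by apply: weakly_compact_map_comp; exact: eta_r_compact.
have -> : (fun a : A => lact (b := dual_bimodule (tensor_bimodule T)) a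
    (derivation_form y)) = (fun a => 1 *: (derivation_form \o eta_l y) a +
      (adjoint (Delta T) \o (adjoint (eta_r y) \o blin_comp D eta)) a).
  by apply/funext => a; rewrite scale1r; exact: derivation_form_lact.
apply: weakly_compact_mapP; apply: weakly_compact_map_comp.
  exact: eta_l_compact.
apply: weakly_compact_map_precomp; apply: weakly_compact_adjoint.
exact: eta_r_compact.
Qed.

Context (m : FA (tensor_bimodule T)).
Hypothesis mP : wap_virtual_diagonal m.
Local Notation e := (Delta_WAP T m : F).

(** At [b = eta a] this is the second condition on a virtual diagonal; density does the rest. *)
Lemma virtual_diagonal_unit_l b : FAalg_mul e b = b.
Proof.
apply: blinP => f; rewrite FAalg_mulE_r.
have H : (fun b : F => b (env_ract f e)) = (fun b => b f).
  apply: (@eta_dense R A) => [||a].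
  - exact: (@sigma_eval_continuous _ _ _ (fun (b : FAalg A) (f : P) => val f b)
      (predual_incl A (env_ract f e))).
  - exact: (@sigma_eval_continuous _ _ _ (fun (b : FAalg A) (f : P) => val f b)
      (predual_incl A f)).
  rewrite -[LHS]FAalg_mulE_r FAalg_mulE env_lact_eta -mP.2 //.
exact: (congr1 (fun g : F -> C => g b) H).
Qed.

(** The relation a.m = m.a passes through the bimodule map [Delta_WAP] to a.e = e.a, which reduces
    [b = eta a] to the second condition on [m]. *)
Lemma virtual_diagonal_unit_r b : FAalg_mul b e = b.
Proof.
apply: blinP => f; rewrite FAalg_mulE.
have H : (fun b : F => b (env_lact e f)) = (fun b => b f).
  apply: (@eta_dense R A) => [||a].
  - exact: (@sigma_eval_continuous _ _ _ (fun (b : FAalg A) (f : P) => val f b)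
      (predual_incl A (env_lact e f))).
  - exact: (@sigma_eval_continuous _ _ _ (fun (b : FAalg A) (f : P) => val f b)
      (predual_incl A f)).
  rewrite -[LHS]FAalg_mulE FAalg_mulE_r env_ract_eta -mP.2.
  have [hl hr] := adjoint_hom (Delta_hom T).
  pose g := blin_restrict (V := WA) (W := wap (dual_bimodule (tensor_bimodule T)))
    (wap_hom (adjoint_hom (Delta_hom T))).
  transitivity (m (wap_r (g f) a)).
    by congr (m _); apply: val_inj; exact: hr.
  transitivity (m (wap_l a (g f))).
    exact: (congr1 (fun n : FA (tensor_bimodule T) => n (g f)) (mP.1 a)).
  by congr (m _); apply: val_inj; exact: (esym (hl _ _)).
exact: (congr1 (fun g : F -> C => g b) H).
Qed.

Definition derivation_wap : blin E (wap (dual_bimodule (tensor_bimodule T))) :=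
  @corestrict R E (dual T) derivation_form
    (wap (dual_bimodule (tensor_bimodule T))) wap_derivation_form.

Definition averaged : dual E := blin_comp m derivation_wap.

(** Apply [m] to [derivation_form_lact]: by a.m = m.a the main terms cancel, and the term from
    [Delta] is [e] at a normal coefficient. *)
Lemma averaged_eta c y : averaged (r y (eta c)) - averaged (l (eta c) y) =
  D (eta c) (r y e).
Proof.
pose w := derivation_wap.
pose g := blin_restrict (V := WA) (W := wap (dual_bimodule (tensor_bimodule T)))
    (wap_hom (adjoint_hom (Delta_hom T))).
have -> : averaged (r y (eta c)) = m (wap_r (w y) c).
  by congr (m _); apply: val_inj; exact: (esym (derivation_form_ract y c)).
have -> : averaged (l (eta c) y) =
    m (wap_l c (w y) - g (normal_coef (D (eta c)) y)).
  congr (m _); apply: val_inj; rewrite raddfB /=.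
  by apply/eqP; rewrite eq_sym subr_eq; apply/eqP; exact: derivation_form_lact.
rewrite linearB /= -[RHS]normal_coefE.
have -> : m (wap_r (w y) c) = m (wap_l c (w y)).
  exact: (congr1 (fun n : FA (tensor_bimodule T) => n (w y)) (mP.1 c)).
by rewrite opprB addrC subrK.
Qed.

Lemma virtual_diagonal_inner : inner D.
Proof.
apply: (@inner_of_unit_corner _ _ _ M D e averaged) => //.
- exact: virtual_diagonal_unit_l.
- exact: virtual_diagonal_unit_r.
(* Paired with [y], the relation e.D b = b.x - x.b equates two weak*-continuous functions of [b],
   which agree on eta(A) by [averaged_eta]. *)
move=> b; apply: blinP => y.
pose g (b : F) := D b (r y e).
pose h (b : F) := averaged (r y b) - averaged (l b y).
suff H : g = h by exact: (congr1 (fun g : F -> C => g b) H).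
apply: (@eta_dense R A) => [||a].
- exact: ((sigma_continuousP _).1 Dc (r y e)).
- move=> z; rewrite /h.
  apply: (@cvgB _ _ (predual_topology P) (nbhs z) _ (fun b => averaged (r y b))
    (fun b => averaged (l b y))).
    exact: (@normal_continuous_r averaged y z).
  exact: (@normal_continuous_l averaged y z).
- exact: (esym (averaged_eta a y)).
Qed.

End VirtualDiagonalToConnes.

(** * Closures of subspaces, and sub-bimodules *)

Section Closure.
Context (R : realType).
Local Notation C := (R[i]).

Lemma closure_ind (T : topologicalType) (V S : set T) :
  closed S -> V `<=` S -> closure V `<=` S.
Proof. by move=> Scl VS x /(closureS VS); exact: Scl. Qed.

Section ClosureSubspace.
Context (E : normedModType C) (V : Defs.subspace E).

Let affine_continuous (a : C) (y : E) : continuous (fun x => a *: x + y).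
Proof.
move=> x; apply: cvgD; last exact: cvg_cst.
by apply: cvgZ; [exact: cvg_cst|exact: cvg_id].
Qed.

Lemma closure_subspaceP (a : C) x y : closure (subspace_set V) x ->
  closure (subspace_set V) y -> closure (subspace_set V) (a *: x + y).
Proof.
move=> Vx Vy; move: y Vy; apply: closure_ind => [|y Vy].
  apply: (proj1 (continuous_closedP (fun y => a *: x + y)) _ _ (@closed_closure _ _)).
  by move=> y; apply: cvgD; [exact: cvg_cst|exact: cvg_id].
move: x Vx; apply: closure_ind => [|x Vx].
  apply: (proj1 (continuous_closedP (fun x => a *: x + y)) _ _ (@closed_closure _ _)).
  exact: affine_continuous.
by apply: subset_closure; exact: subspaceP.
Qed.

Definition closure_subspace : Defs.subspace E :=
  Subspace (subset_closure (subspace0 V)) closure_subspaceP.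

Lemma closure_subspace_stable (T : blin E E) :
  (forall x, subspace_set V x -> subspace_set V (T x)) ->
  forall x, subspace_set closure_subspace x -> subspace_set closure_subspace (T x).
Proof.
move=> TV; apply: closure_ind => [|x Vx]; last exact/subset_closure/TV.
apply: (proj1 (continuous_closedP T) _ _ (@closed_closure _ _)).
exact: blin_cont.
Qed.

Lemma closure_subspace_dense (Z : normedModType C) (S : blin closure_subspace Z)
    (Q : set Z) : closed Q ->
  (forall x : closure_subspace, subspace_set V (val x) -> Q (S x)) ->
  forall x, Q (S x).
Proof.
move=> Qcl VQ x.
have SQ : closed (S @^-1` Q).
  by apply: (proj1 (continuous_closedP S) _ _ Qcl); exact: blin_cont.
apply: SQ => B /nbhs_ballP[e /= e0 eB].
have [y [Vy xy]] := subspace_valP x (ball (val x) e) (nbhsx_ballx _ _ e0).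
pose y' : closure_subspace := @mksub _ _ closure_subspace y (subset_closure Vy).
exists y'; split; first exact: VQ.
apply: eB; move: xy; rewrite -!ball_normE /=.
by have -> : val x - y = val (x - y') by rewrite raddfB.
Qed.

End ClosureSubspace.
End Closure.

Section SubBimodule.
Context (R : realType) (B : normedModType R[i]) (mul : B -> B -> B).
Context (X : bimodule mul) (V : Defs.subspace X).
Let Xax := bm_axiom X.
Hypothesis Vl : forall b x, subspace_set V x -> subspace_set V (lact_blin X b x).
Hypothesis Vr : forall b x, subspace_set V x -> subspace_set V (ract_blin X b x).

Definition sub_lact (b : B) (x : V) : V :=
  blin_restrict (V := V) (W := V) (@Vl b) x.
Definition sub_ract (x : V) (b : B) : V :=
  blin_restrict (V := V) (W := V) (@Vr b) x.

Lemma sub_is_bimodule : is_bimodule mul sub_lact sub_ract.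
Proof.
have [[ll lr] [k kP]] := bm_lbilin Xax; have [[rl rr] [h hP]] := bm_rbilin Xax.
split.
- split; first split.
  + move=> x c a b; apply: val_inj; rewrite linearP /=; exact: (ll (val x)).
  + by move=> a c x y; rewrite /sub_lact linearP.
  + by exists k => a x; exact: (kP a (val x)).
- split; first split.
  + by move=> a c x y; rewrite /sub_ract linearP.
  + move=> x c a b; apply: val_inj; rewrite linearP /=; exact: (rr (val x)).
  + by exists h => x a; exact: (hP (val x) a).
- by move=> a b x; apply: val_inj; exact: (bm_lA Xax).
- by move=> x a b; apply: val_inj; exact: (bm_rA Xax).
- by move=> a x b; apply: val_inj; exact: (bm_lrA Xax).
Qed.

Definition sub_bimodule : bimodule mul := Bimodule sub_is_bimodule.

End SubBimodule.

(** * The unit of a Connes-amenable F(A) *)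

Section ConnesToVirtualDiagonal.
Context (R : realType) (A : banachAlg R).
Local Notation C := (R[i]).
Local Notation mul := (@ba_mul R A).
Local Notation RA := (regular A).
Local Notation F := (dual (FA_pre RA)).
Local Notation P := (FAalg_predual A).
Local Notation eta := (FA_eta RA).
Local Notation WA := (wap (dual_bimodule RA)).

Hypothesis CA : connes_amenable (@FAalg_mul R A) P.

(* The bimodule G need not be complete as a structure: an isomorphic complete
   copy E is enough. *)
Lemma connes_inner (G : bimodule (@FAalg_mul R A)) (E : completeNormedModType C)
    (j : blin E G) (i : blin G E) (D : blin F (dual_bimodule G)) :
  cancel j i -> cancel i j ->
  (forall phi y, subspace_set P
    (transpose (lorbit (X := dual_bimodule G) phi : blin F (dual G)) y)) ->
  (forall phi y, subspace_set P
    (transpose (rorbit (X := dual_bimodule G) phi : blin F (dual G)) y)) ->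
  (forall y, subspace_set P (transpose (D : blin F (dual G)) y)) ->
  derivation (D : FAalg A -> dual_bimodule G) ->
  inner (D : FAalg A -> dual_bimodule G).
Proof.
move=> jK iK Gl Gr DP Dd; have Gax := bm_axiom G.
pose l (b : FAalg A) (x : E) : E := i (lact b (j x)).
pose r (x : E) (b : FAalg A) : E := i (ract (j x) b).
have El : is_bimodule (@FAalg_mul R A) l r.
  have [k k0 kP] := bounded_bilin_ge0 (bm_lbilin Gax).
  have [h h0 hP] := bounded_bilin_ge0 (bm_rbilin Gax).
  split.
  - split; first split.
    + move=> x; exact: (linearP (blin_comp i (lorbit (j x)))).
    + move=> b; exact: (linearP (blin_comp i (blin_comp (lact_blin G b) j))).
    + exists (`|i| * (k * `|j|)) => b x; apply: le_trans (le_blin_norm i _) _.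
      rewrite -!mulrA ler_wpM2l//; apply: le_trans (kP _ _) _.
      rewrite -mulrA ler_wpM2l// mulrCA ler_wpM2l//; exact: le_blin_norm.
  - split; first split.
    + move=> b; exact: (linearP (blin_comp i (blin_comp (ract_blin G b) j))).
    + move=> x; exact: (linearP (blin_comp i (rorbit (j x)))).
    + exists (`|i| * (h * `|j|)) => x b; apply: le_trans (le_blin_norm i _) _.
      rewrite -!mulrA ler_wpM2l//; apply: le_trans (hP _ _) _.
      by rewrite -mulrA ler_wpM2l// mulrA ler_wpM2r//; exact: le_blin_norm.
  - by move=> a b x; rewrite /l iK (bm_lA Gax).
  - by move=> x a b; rewrite /r iK (bm_rA Gax).
  - by move=> a x b; rewrite /l /r !iK (bm_lrA Gax).
pose D' : blin (FAalg A) (dual_bimodule (Bimodule El)) := blin_comp (adjoint j) D.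
have nd : normal_dual P (Bimodule El).
  move=> phi; split.
    apply: (predual_continuous (S := lorbit (X := dual_bimodule (Bimodule El)) phi)) => y.
    suff -> : transpose (lorbit (X := dual_bimodule (Bimodule El)) phi : blin F (dual E)) y =
      transpose (lorbit (X := dual_bimodule G) (blin_comp phi i) : blin F (dual G)) (j y).
      exact: Gl.
    exact: blinP.
  apply: (predual_continuous (S := rorbit (X := dual_bimodule (Bimodule El)) phi)) => y.
  suff -> : transpose (rorbit (X := dual_bimodule (Bimodule El)) phi : blin F (dual E)) y =
    transpose (rorbit (X := dual_bimodule G) (blin_comp phi i) : blin F (dual G)) (j y).
    exact: Gr.
  exact: blinP.
have [_ CA2] := CA.
have [||n nP] := CA2 E l r El nd D'.
- move=> a b; apply: blinP => y.
  have /= -> := congr1 (fun g : dual G => g (j y)) (Dd a b).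
  by rewrite /= !iK.
- apply: predual_continuous => y.
  suff -> : transpose (D' : blin F (dual E)) y = transpose (D : blin F (dual G)) (j y) by [].
  exact: blinP.
exists (blin_comp n i) => b; apply: blinP => y.
have := congr1 (fun g : dual E => g (i y)) (nP b).
by rewrite /= /l /r !iK.
Qed.

Definition WA_complete : completeNormedModType C :=
  @closed_subspace R (dual A) WA (@wap_closed R A RA).

Let zero_bilin (E G H : normedModType C) : bounded_bilin (fun (_ : E) (_ : G) => 0 : H).
Proof.
split; first by split=> ? ? ? ?; rewrite scaler0 addr0.
by exists 0 => x y; rewrite normr0 !mul0r.
Qed.

Lemma zero_l_bimodule : is_bimodule (@FAalg_mul R A)
  (fun _ _ => 0 : WA) (@env_ract R A RA).
Proof.
split; [exact: zero_bilin|exact: (@env_ract_bilin R A RA)| | |] => //.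
  exact: (@env_ractA R A RA).
by move=> b x c; exact: (linear0 (ract_blin (env_bimodule RA) c)).
Qed.

Lemma zero_r_bimodule : is_bimodule (@FAalg_mul R A)
  (@env_lact R A RA) (fun _ _ => 0 : WA).
Proof.
split; [exact: (@env_lact_bilin R A RA)|exact: zero_bilin| | |] => //.
  exact: (@env_lactA R A RA).
by move=> b x c; exact: (esym (linear0 (lact_blin (env_bimodule RA) b))).
Qed.

(** With zero left action on W(A), the dual F(A) has its product as left action and zero right
    action. The identity map is then a derivation, and if [n] implements it, b = b n. *)
Lemma connes_right_unit : exists e : F, forall b, FAalg_mul b e = b.
Proof.
have [||||n nP] := @connes_inner (Bimodule zero_l_bimodule) WA_complete
  (closed_subspace_val _) (closed_subspace_mk _) (blin_id F)
  (@closed_subspace_valK _ _ _ _) (@closed_subspace_mkK _ _ _ _).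
- move=> phi y.
  suff -> : transpose (lorbit (X := dual_bimodule (Bimodule zero_l_bimodule)) phi :
    blin F (dual WA)) y = transpose (lorbit (X := dual_bimodule (env_bimodule RA)) phi) y.
    exact: predual_orbit_r.
  exact: blinP.
- move=> phi y.
  suff -> : transpose (rorbit (X := dual_bimodule (Bimodule zero_l_bimodule)) phi :
    blin F (dual WA)) y = 0 by exact: subspace0.
  by apply: blinP => b; exact: linear0.
- move=> y; exists y => //; exact: blinP.
- move=> a b; apply: blinP => f.
  rewrite [LHS](FAalg_mulE_r a b f) /= -[LHS]addr0; congr (_ + _).
  by apply: esym; exact: linear0.
exists n => b; apply: blinP => f; rewrite FAalg_mulE_r.
have /= -> := congr1 (fun g : F => g f) (nP b).
by rewrite /= linear0 subr0.
Qed.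

Lemma connes_left_unit : exists e : F, forall b, FAalg_mul e b = b.
Proof.
have [||||n nP] := @connes_inner (Bimodule zero_r_bimodule) WA_complete
  (closed_subspace_val _) (closed_subspace_mk _) (blin_id F)
  (@closed_subspace_valK _ _ _ _) (@closed_subspace_mkK _ _ _ _).
- move=> phi y.
  suff -> : transpose (lorbit (X := dual_bimodule (Bimodule zero_r_bimodule)) phi :
    blin F (dual WA)) y = 0 by exact: subspace0.
  by apply: blinP => b; exact: linear0.
- move=> phi y.
  suff -> : transpose (rorbit (X := dual_bimodule (Bimodule zero_r_bimodule)) phi :
    blin F (dual WA)) y = transpose (rorbit (X := dual_bimodule (env_bimodule RA)) phi) y.
    exact: predual_orbit_l.
  exact: blinP.
- move=> y; exists y => //; exact: blinP.
- move=> a b; apply: blinP => f.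
  rewrite [LHS](FAalg_mulE a b f) /= -[LHS]add0r; congr (_ + _).
  by apply: esym; exact: linear0.
(* Now the left action on the dual is zero, so innerness reads b = - n b. *)
exists (- n) => b; apply: blinP => f; rewrite FAalg_mulE.
have /= -> := congr1 (fun g : F => g f) (nP b).
by rewrite /= linear0 sub0r.
Qed.

Lemma connes_unit : exists e : F,
  (forall b, FAalg_mul e b = b) /\ (forall b, FAalg_mul b e = b).
Proof.
have [[e eP] [e' e'P]] := (connes_left_unit, connes_right_unit).
by exists e; split=> // b; rewrite -{2}[b]e'P -[e](e'P e) eP.
Qed.

End ConnesToVirtualDiagonal.

(** * From Connes-amenability to a virtual diagonal *)

Section VirtualDiagonalOfConnes.
Context (R : realType) (A : banachAlg R) (T : projTensor A A).
Local Notation C := (R[i]).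
Local Notation mul := (@ba_mul R A).
Local Notation RA := (regular A).
Local Notation F := (dual (FA_pre RA)).
Local Notation P := (FAalg_predual A).
Local Notation eta := (FA_eta RA).
Local Notation WA := (wap (dual_bimodule RA)).
Local Notation X := (tensor_bimodule T).
Local Notation WT := (wap (dual_bimodule X)).

Definition tens (a : A) : blin A T.
Proof.
refine (@mkblin _ A T (pt_tens T a) _ _); first exact: (pt_bilin T).2.
by exists `|a| => b; exact: pt_norm.
Defined.

Definition tensor_curry (f : dual T) : blin A (dual A).
Proof.
refine (@mkblin _ A (dual A) (fun a => blin_comp f (tens a)) _ _).
- by move=> c a a'; apply: blinP => b /=; rewrite ((pt_bilin T).1 b) linearP.
- exists `|f| => a; apply: blin_norm_le => [|b]; first by rewrite mulr_ge0.
  apply: le_trans (le_blin_norm f _) _.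
  by rewrite -mulrA ler_wpM2l//; exact: pt_norm.
Defined.

Lemma tensor_curryE f a b : tensor_curry f a b = f (pt_tens T a b).
Proof. by []. Qed.

Lemma tensor_curry_norm f : `|tensor_curry f| <= `|f|.
Proof.
apply: blin_norm_le => // a; apply: blin_norm_le => [|b]; first by rewrite mulr_ge0.
rewrite tensor_curryE; apply: le_trans (le_blin_norm f _) _.
by rewrite -mulrA ler_wpM2l//; exact: pt_norm.
Qed.

(* M (x) M, read as f |-> M(a |-> M(b |-> f(a (x) b))). *)
Definition bidual_tensor (M : dual (dual A)) : dual (dual T).
Proof.
refine (@mkblin _ (dual T) C (fun f => M (blin_comp M (tensor_curry f))) _ _).
- move=> c f g; rewrite -linearP; congr (M _); apply: blinP => a /=.
  rewrite -[RHS](linearP M); congr (M _); exact: blinP.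
- exists (`|M| * `|M|) => f; apply: le_trans (le_blin_norm M _) _.
  rewrite -mulrA ler_wpM2l//; apply: blin_norm_le => [|a]; first by rewrite mulr_ge0.
  apply: le_trans (le_blin_norm M _) _; rewrite -mulrA ler_wpM2l//.
  apply: le_trans (le_blin_norm (tensor_curry f) a) _.
  by rewrite ler_wpM2r// tensor_curry_norm.
Defined.

Definition Delta_wap : blin WA WT :=
  blin_restrict (V := WA) (W := WT) (wap_hom (adjoint_hom (Delta_hom T))).

Lemma Delta_wapl b f : Delta_wap (env_lact b f) = env_lact b (Delta_wap f).
Proof.
apply: wap_inj => t.
rewrite env_lactE; transitivity (val (env_lact b f) (Delta T t)); first by [].
rewrite env_lactE; congr (b _); apply: wap_inj => a /=.
by congr (val f _); exact: (esym ((Delta_hom T).2 t a)).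
Qed.

Lemma Delta_wapr f b : Delta_wap (env_ract f b) = env_ract (Delta_wap f) b.
Proof.
apply: wap_inj => t.
rewrite env_ractE; transitivity (val (env_ract f b) (Delta T t)); first by [].
rewrite env_ractE; congr (b _); apply: wap_inj => a /=.
by congr (val f _); exact: (esym ((Delta_hom T).1 a t)).
Qed.

Definition unit_tensor (e : F) : FA X := FA_quot X (bidual_tensor (FA_lift e)).

(** The left side is e(a |-> e(b |-> f(ab))), and the inner value is f(a) because [e] is a right
    unit. *)
Lemma unit_tensorE (e : F) (f : WA) : (forall b, FAalg_mul b e = b) ->
  unit_tensor e (Delta_wap f) = e f.
Proof.
move=> be; rewrite -[RHS]FA_liftE /=; congr (FA_lift e _); apply: blinP => a.
have H : e (env_ract f (eta a)) = val f a.
  by rewrite -FAalg_mulE_r be.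
rewrite -H env_ract_eta -FA_liftE /=; congr (FA_lift e _); apply: blinP => b.
have Dab : Delta T (pt_tens T a b) = mul a b by exact: pt_liftE.
exact: (congr1 (val f) Dab).
Qed.

Context (e : F) (n : FA X).
Hypothesis eb : forall b, FAalg_mul e b = b.
Hypothesis be : forall b, FAalg_mul b e = b.
Hypothesis nE : forall f, n (Delta_wap f) = e f.

Local Notation FX := (dual_bimodule (env_bimodule X)).

Definition Delta_ker : Defs.subspace FX.
Proof.
refine (@Subspace _ FX [set k : FX | forall f, (k : FA X) (Delta_wap f) = 0] _ _).
- by [].
- by move=> c k h k0 h0 f; rewrite blinDE blinZE k0 h0 scaler0 addr0.
Defined.

Lemma Delta_ker_lact b k : subspace_set Delta_ker k ->
  subspace_set Delta_ker (lact_blin FX b k).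
Proof. by move=> k0 f; have := k0 (env_ract f b); rewrite Delta_wapr. Qed.

Lemma Delta_ker_ract b k : subspace_set Delta_ker k ->
  subspace_set Delta_ker (ract_blin FX b k).
Proof. by move=> k0 f; have := k0 (env_lact b f); rewrite Delta_wapl. Qed.

Definition Delta_ker_bimodule : bimodule (@FAalg_mul R A) :=
  sub_bimodule Delta_ker_lact Delta_ker_ract.
Local Notation DK := (dual_bimodule Delta_ker_bimodule).

Definition eval_ker : blin WT (dual Delta_ker_bimodule) :=
  blin_comp (adjoint (subspace_incl Delta_ker)) (bidual WT).

Lemma eval_kerl b w : eval_ker (env_lact b w) = lact (b := DK) b (eval_ker w).
Proof. exact: blinP. Qed.
Lemma eval_kerr w b : eval_ker (env_ract w b) = ract (b := DK) (eval_ker w) b.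
Proof. exact: blinP. Qed.

(* The predual of ker Delta_WAP should be a quotient of W(A (x) A); the closure
   of the image of W(A (x) A) in (ker Delta_WAP)^* avoids quotient norms. *)
Definition ker_predual : Defs.subspace DK :=
  closure_subspace (range_subspace eval_ker : Defs.subspace DK).

Lemma ker_predual_lact b x : subspace_set ker_predual x ->
  subspace_set ker_predual (lact_blin DK b x).
Proof.
apply: closure_subspace_stable => _ [w _ <-].
by exists (env_lact b w) => //; exact: eval_kerl.
Qed.

Lemma ker_predual_ract b x : subspace_set ker_predual x ->
  subspace_set ker_predual (ract_blin DK b x).
Proof.
apply: closure_subspace_stable => _ [w _ <-].
by exists (env_ract w b) => //; exact: eval_kerr.
Qed.

Definition ker_predual_bimodule : bimodule (@FAalg_mul R A) :=
  sub_bimodule ker_predual_lact ker_predual_ract.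

Local Notation KP := ker_predual_bimodule.

Lemma eval_range w : subspace_set ker_predual (eval_ker w).
Proof. by apply: subset_closure; exists w. Qed.

Definition to_ker_predual : blin WT KP :=
  @corestrict _ _ _ eval_ker ker_predual eval_range.

Lemma to_ker_predual_lact b w : to_ker_predual (env_lact b w) = lact b (to_ker_predual w).
Proof. by apply: val_inj; exact: eval_kerl. Qed.
Lemma to_ker_predual_ract w b : to_ker_predual (env_ract w b) = ract (to_ker_predual w) b.
Proof. by apply: val_inj; exact: eval_kerr. Qed.

(** The image of W(A (x) A) is dense in [ker_predual], and the predual of F(A) is closed. *)
Lemma ker_predual_orbit (S : blin F (dual KP)) :
  (forall w, subspace_set P (transpose S (to_ker_predual w))) ->
  forall y, subspace_set P (transpose S y).
Proof.
move=> H; apply: (@closure_subspace_dense _ _ _ _ (transpose S)).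
  exact: predual_closed.
move=> y [w _ wy]; suff -> : y = to_ker_predual w by [].
by apply: val_inj; rewrite -wy.
Qed.

Definition ad_fun : blin F FX :=
  (lorbit (X := FX) n : blin F FX) - (rorbit (X := FX) n : blin F FX).

Lemma ad_funE b w : (ad_fun b : FA X) w = n (env_ract w b) - n (env_lact b w).
Proof. by []. Qed.

(** [Delta_WAP] sends b.n - n.b to b e - e b, which is zero for a unit [e]. *)
Lemma ad_ker b : subspace_set Delta_ker (ad_fun b).
Proof.
move=> f; rewrite ad_funE; apply/eqP; rewrite subr_eq0; apply/eqP.
rewrite -Delta_wapl -Delta_wapr !nE.
by rewrite -FAalg_mulE -FAalg_mulE_r eb be.
Qed.

Definition ad : blin F Delta_ker_bimodule :=
  @corestrict _ _ _ ad_fun Delta_ker ad_ker.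

(** Innerness is available in duals, so [ad] is carried from the kernel into the dual of
    [ker_predual]. *)
Definition ad_dual : blin F (dual KP) :=
  blin_comp (adjoint (subspace_incl ker_predual)) (blin_comp (bidual Delta_ker_bimodule) ad).

Lemma ad_funM a b w : (ad_fun (FAalg_mul a b) : FA X) w =
  (ad_fun b : FA X) (env_ract w a) + (ad_fun a : FA X) (env_lact b w).
Proof.
have H : n (env_ract w (FAalg_mul a b)) - n (env_lact (FAalg_mul a b) w) =
    n (env_ract (env_ract w a) b) - n (env_lact b (env_ract w a)) +
    (n (env_ract (env_lact b w) a) - n (env_lact a (env_lact b w))).
  by rewrite env_ractA env_lactA env_lractA addrA subrK.
exact: H.
Qed.

Lemma ad_derivation : derivation (ad : FAalg A -> Delta_ker_bimodule).
Proof.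
move=> a b; apply: val_inj; rewrite raddfD; apply: blinP => w.
exact: ad_funM.
Qed.

Lemma ad_dual_derivation : derivation (ad_dual : FAalg A -> dual_bimodule KP).
Proof.
move=> a b; apply: blinP => y.
have := congr1 (fun k : Delta_ker_bimodule => val y k) (ad_derivation a b).
by rewrite linearD.
Qed.

Lemma ad_dual_predual y : subspace_set P (transpose ad_dual y).
Proof.
apply: ker_predual_orbit => w.
have [u _ uE] := predual_orbit_r n w; have [v _ vE] := predual_orbit_l n w.
exists (u - v) => //; apply: blinP => b.
have ub : b u = n (env_ract w b) := congr1 (fun p : dual F => p b) uE.
have vb : b v = n (env_lact b w) := congr1 (fun p : dual F => p b) vE.
transitivity (b u - b v); first exact: linearB.
by rewrite ub vb.
Qed.

(** On the dense image of W(A (x) A), pulling [phi] back along [to_ker_predual] reduces this to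
    normality of F_A(A (x) A). *)
Lemma ker_predual_lorbit (phi : dual_bimodule KP) y : subspace_set P
  (transpose (lorbit (X := dual_bimodule KP) phi : blin F (dual KP)) y).
Proof.
apply: ker_predual_orbit => w.
suff -> : transpose (lorbit (X := dual_bimodule KP) phi : blin F (dual KP))
    (to_ker_predual w) =
  transpose (lorbit (X := FX) (blin_comp phi to_ker_predual) : blin F (dual WT)) w.
  exact: predual_orbit_r.
by apply: blinP => b; congr (phi _); exact: (esym (to_ker_predual_ract w b)).
Qed.

Lemma ker_predual_rorbit (phi : dual_bimodule KP) y : subspace_set P
  (transpose (rorbit (X := dual_bimodule KP) phi : blin F (dual KP)) y).
Proof.
apply: ker_predual_orbit => w.
suff -> : transpose (rorbit (X := dual_bimodule KP) phi : blin F (dual KP))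
    (to_ker_predual w) =
  transpose (rorbit (X := FX) (blin_comp phi to_ker_predual) : blin F (dual WT)) w.
  exact: predual_orbit_l.
by apply: blinP => b; congr (phi _); exact: (esym (to_ker_predual_lact b w)).
Qed.

Lemma connes_virtual_diagonal : connes_amenable (@FAalg_mul R A) P ->
  exists m : FA X, wap_virtual_diagonal m.
Proof.
move=> CA.
have Ecl : closed (subspace_set ker_predual) by exact: closed_closure.
have [k kP] := @connes_inner R A CA KP (closed_subspace Ecl)
  (closed_subspace_val Ecl) (closed_subspace_mk Ecl) ad_dual
  (@closed_subspace_valK _ _ _ Ecl) (@closed_subspace_mkK _ _ _ Ecl)
  ker_predual_lorbit ker_predual_rorbit ad_dual_predual ad_dual_derivation.
(* The pullback of [k] to W(A (x) A) has the same commutators with F(A) as [n], so the difference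
   commutes with A. *)
pose m : FA X := n - blin_comp k to_ker_predual.
have mD (f : WA) : m (Delta_wap f) = e f.
  (* Elements of the kernel of [Delta_WAP] vanish on the range of [Delta_wap], so the correction
     leaves the image [e] unchanged. *)
  have i0 : to_ker_predual (Delta_wap f) = 0.
    by apply: val_inj; apply: blinP => h; exact: (subspace_valP h f).
  transitivity (n (Delta_wap f) - k (to_ker_predual (Delta_wap f))) => //.
  by rewrite i0 linear0 subr0 nE.
exists m; split=> a; apply: blinP => w.
  have H : n (env_ract w (eta a)) - n (env_lact (eta a) w) =
      k (to_ker_predual (env_ract w (eta a))) - k (to_ker_predual (env_lact (eta a) w)).
    rewrite to_ker_predual_ract to_ker_predual_lact.
    exact: (congr1 (fun g : dual KP => g (to_ker_predual w)) (kP (eta a))).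
  transitivity (n (env_ract w (eta a)) - k (to_ker_predual (env_ract w (eta a)))).
    by rewrite env_ract_eta.
  transitivity (n (env_lact (eta a) w) - k (to_ker_predual (env_lact (eta a) w))); last first.
    by rewrite env_lact_eta.
  move: (k _) (k _) (n _) (n _) H => v u y x H.
  have -> : x = u - v + y by rewrite -H subrK.
  by rewrite addrAC (addrC u) addrK addrC.
transitivity (e (env_lact (eta a) w)); first by rewrite env_lact_eta -mD.
by rewrite -FAalg_mulE eb.
Qed.

End VirtualDiagonalOfConnes.

Theorem theorem6p12 (R : realType) (A : banachAlg R) (T : projTensor A A) :
  connes_amenable (@FAalg_mul R A) (FAalg_predual A) <->
  exists m : FA (tensor_bimodule T), wap_virtual_diagonal m.
Proof.
split=> [CA|[m mP]].
  have [e [eb be]] := connes_unit CA.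
  exact: (connes_virtual_diagonal eb be (fun f => unit_tensorE T f be) CA).
split=> [|E l r El M Enorm D Dd Dc]; first exact: FA_is_dual_banach_algebra.
exact: (virtual_diagonal_inner Enorm Dd Dc mP).
Qed.
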